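(* Let $X$ be the union of finitely many unit triangles of the triangular lattice. Suppose that the boundary $\partial X$ consists of a single simple closed curve. Then the truss $X$ is generic: the number $c$ of compatibility conditions for the prescribed elongations problem equals the Maxwell number, which also equals the number $v_i$ of interior vertices, $$c=\mathcal C_M=v_i .$$ Moreover, a basis for the compatibility conditions is given by the wagon wheel conditions centered at the interior vertices, each of which is supported on the hexagon neighborhood of its vertex.
   Context: The triangular lattice is the set of points $k\mathbf e_1+\ell\mathbf e_2$, $k,\ell\in\mathbb Z$, $\mathbf e_1=(1,0)$, $\mathbf e_2=(1/2,\sqrt3/2)$; its unit triangles are the equilateral triangles of side 1 with lattice vertices. The truss of $X$ has as vertices and edges the vertices and edges of the unit triangles in $X$; let $v$ and $e$ be their numbers. Prescribed elongations problem: given $\lambda\in\mathbf R^e$ find displacements $U_i\in\mathbf R^2$ at the vertices with $(V_i-V_j)\cdot(U_i-U_j)=\lambda_{ij}$ for every edge $V_iV_j$; write this as $AU=\lambda$. Since all edges have unit length, $\lambda_{ij}$ equals the elongation $L_{ij}$. The number of compatibility conditions $c$ is the codimension in $\mathbf R^e$ of the range of $A$; the space of compatibility conditions is the space of linear functionals on $\mathbf R^e$ vanishing on the range of $A$. The Maxwell number is $\mathcal C_M=e-2v+3$; the truss is generic if $c=\mathcal C_M$. For an interior vertex $V_0$ with six neighbors $V_1,\dots,V_6$ in cyclic order (indices mod 6), the wagon wheel condition is $\sum_{i=1}^6L_{i,i+1}-\sum_{i=1}^6L_{0,i}=0$, where $L_{i,j}$ is the elongation of $V_iV_j$. *)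

(* Defs.v *)
From HB Require Import structures.
From mathcomp Require Import all_boot all_order all_algebra finmap.
From mathcomp Require Import all_classical all_reals all_analysis.

Set Implicit Arguments.
Unset Strict Implicit.
Unset Printing Implicit Defensive.

Import Order.TTheory GRing.Theory Num.Theory.
Import numFieldNormedType.Exports.

Local Open Scope classical_set_scope.
Local Open Scope fset_scope.
Local Open Scope ring_scope.

Definition dot (R : realType) (u v : 'rV[R]_2) : R := \sum_j u 0 j * v 0 j.

(* The norm carried by 'rV[R]_2 is the sup norm, hence this definition; both
   norms induce the same topology. *)
Definition eucl_norm (R : realType) (u : 'rV[R]_2) : R := Num.sqrt (dot u u).

(* (k, l) stands for k e_1 + l e_2. *)
Notation lattice := (int * int)%type.

Definition e1 (R : realType) : 'rV[R]_2 := \row_j [:: 1; 0]`_j.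
Definition e2 (R : realType) : 'rV[R]_2 :=
  \row_j [:: 1 / 2%:R; Num.sqrt 3%:R / 2%:R]`_j.

Definition pt (R : realType) (p : lattice) : 'rV[R]_2 :=
  p.1%:~R *: e1 R + p.2%:~R *: e2 R.

(* A triangle is given by the set of its three vertices. *)
Definition unit_triangle (R : realType) (t : {fset lattice}) : Prop :=
  #|` t| = 3 /\
  (forall p q, p \in t -> q \in t -> p != q -> eucl_norm (pt R p - pt R q) = 1).

(* The convex hull of finitely many lattice points. *)
Definition hull (R : realType) (s : {fset lattice}) : set 'rV[R]_2 :=
  [set x | exists2 w : lattice -> R,
     (forall p, p \in s -> 0 <= w p) /\ \sum_(p <- s) w p = 1
   & x = \sum_(p <- s) w p *: pt R p].
Arguments hull R s : clear implicits.

(* T is the collection of the unit triangles that make up X. *)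
Definition region (R : realType) (T : {fset {fset lattice}}) : set 'rV[R]_2 :=
  \bigcup_(t in [set` T]) hull R t.
Arguments region R T : clear implicits.

Definition boundary (S : topologicalType) (A : set S) : set S :=
  closure A `\` interior A.

Definition simple_closed_curve (R : realType) (S : topologicalType)
    (C : set S) : Prop :=
  exists gamma : R -> S,
    [/\ {within `[0, 1], continuous gamma},
        gamma 0 = gamma 1,
        (forall s t : R, 0 <= s < 1 -> 0 <= t < 1 ->
           gamma s = gamma t -> s = t)
      & (gamma @` `[0, 1])%classic = C].

Definition vertices (T : {fset {fset lattice}}) : {fset lattice} :=
  \bigcup_(t <- T) t.

(* An edge is given by the set of its two end points. *)
Definition edges (T : {fset {fset lattice}}) : {fset {fset lattice}} :=
  \bigcup_(t <- T) [fset e in fpowerset t | #|` e| == 2]%fset.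

Definition interior_vertices (R : realType) (T : {fset {fset lattice}}) :
    {fset lattice} :=
  [fset p in vertices T | `[< interior (region R T) (pt R p) >]]%fset.

Definition displacements (R : realType) (T : {fset {fset lattice}}) :=
  {ffun vertices T -> 'rV[R]_2}.

Definition elongations (R : realType) (T : {fset {fset lattice}}) :=
  {ffun edges T -> R^o}.

HB.instance Definition _ R T := Vector.on (displacements R T).
HB.instance Definition _ R T := Vector.on (elongations R T).

(* The value of f at x, where x is not known to be in D by typing; the value 0
   outside D is junk. It is only ever read at the end points of an edge of the
   truss, or, around an interior vertex, at edges of the truss. *)
Definition at_ (K : choiceType) (W : zmodType) (D : {fset K})
    (f : {ffun D -> W}) (x : K) : W :=
  oapp f 0 (insub x).

(* Edges have unit length, so (V_i - V_j).(U_i - U_j) is the elongation. It is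
   symmetric in the two end points (see [stretchE]), so the
   order in which the edge lists them is irrelevant. *)
Definition stretch (R : realType) (T : {fset {fset lattice}})
    (U : displacements R T) : elongations R T :=
  [ffun e : edges T =>
     let i := (enum_fset (val e))`_0 in let j := (enum_fset (val e))`_1 in
     dot (pt R i - pt R j) (at_ U i - at_ U j)].

Definition stretch_map (R : realType) (T : {fset {fset lattice}}) :
    'Hom(displacements R T, elongations R T) :=
  linfun (@stretch R T).

Definition num_compat (R : realType) (T : {fset {fset lattice}}) : nat :=
  (\dim {: elongations R T} - \dim (limg (stretch_map R T)))%N.

Definition comp_stretch (R : realType) (T : {fset {fset lattice}})
    (phi : 'Hom(elongations R T, R^o)) : 'Hom(displacements R T, R^o) :=
  (phi \o stretch_map R T)%VF.

(* The functionals vanishing on the range of [stretch_map] (see [mem_compat]). *)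
Definition compat (R : realType) (T : {fset {fset lattice}}) :
    {vspace 'Hom(elongations R T, R^o)} :=
  lker (linfun (@comp_stretch R T)).

Definition maxwell (T : {fset {fset lattice}}) : int :=
  #|` edges T|%:Z - 2 * #|` vertices T|%:Z + 3.

Definition generic (R : realType) (T : {fset {fset lattice}}) : Prop :=
  (num_compat R T)%:Z = maxwell T.

(* The six neighbours of p, counterclockwise from p + e_1; [ordS] is the cyclic
   successor. *)
Definition nbr (p : lattice) (i : 'I_6) : lattice :=
  p + [:: (1, 0); (0, 1); (-1, 1); (-1, 0); (0, -1); (1, -1)]`_i.

Definition hexagon (p : lattice) : {fset {fset lattice}} :=
  [fset [fset p; nbr p i; nbr p (ordS i)] | i : 'I_6]%fset.

Definition elong (R : realType) (T : {fset {fset lattice}})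
    (L : elongations R T) (p q : lattice) : R :=
  at_ L [fset p; q]%fset.

Definition wagon_fun (R : realType) (T : {fset {fset lattice}}) (p : lattice)
    (L : elongations R T) : R^o :=
  \sum_(i < 6) elong L (nbr p i) (nbr p (ordS i)) - \sum_(i < 6) elong L p (nbr p i).

Definition wagon (R : realType) (T : {fset {fset lattice}}) (p : lattice) :
    'Hom(elongations R T, R^o) :=
  linfun (@wagon_fun R T p).

Definition supported_on (R : realType) (T : {fset {fset lattice}})
    (S : {fset {fset lattice}}) (phi : 'Hom(elongations R T, R^o)) : Prop :=
  forall L : elongations R T,
    (forall e : edges T, val e \in S -> L e = 0) -> phi L = 0.

Lemma at_in (K : choiceType) (W : zmodType) (D : {fset K})
    (f : {ffun D -> W}) (x : D) : at_ f (val x) = f x.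
Proof. by rewrite /at_ valK. Qed.

Lemma at_linear (F : nzRingType) (K : choiceType) (W : lmodType F) (D : {fset K})
    (x : K) : linear (fun f : {ffun D -> W} => at_ f x).
Proof.
move=> a f g; rewrite /at_; case: insub => [y|] /=; first by rewrite !ffunE.
by rewrite scaler0 addr0.
Qed.

Lemma dotC (R : realType) (u v : 'rV[R]_2) : dot u v = dot v u.
Proof. by apply: eq_bigr => j _; rewrite mulrC. Qed.

Lemma dot_linear (R : realType) (u : 'rV[R]_2) :
  linear (dot u : 'rV[R]_2 -> R^o).
Proof.
move=> a v w; rewrite /dot scaler_sumr -big_split /=; apply: eq_bigr => j _.
by rewrite !mxE mulrDr mulrCA.
Qed.

Lemma dotNN (R : realType) (u v : 'rV[R]_2) : dot (- u) (- v) = dot u v.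
Proof. by apply: eq_bigr => j _; rewrite !mxE mulrNN. Qed.

Lemma stretch_linear (R : realType) (T : {fset {fset lattice}}) :
  linear (@stretch R T).
Proof.
move=> a f g; apply/ffunP => e; rewrite !ffunE /=.
set i := nth _ _ 0; set j := nth _ _ 1.
rewrite -dot_linear !at_linear; congr (dot _ _).
by rewrite opprD addrACA -scalerBr.
Qed.

HB.instance Definition _ (R : realType) (T : {fset {fset lattice}}) :=
  GRing.isLinear.Build R (displacements R T) (elongations R T) _ (@stretch R T)
    (@stretch_linear R T).

Lemma stretch_mapE (R : realType) (T : {fset {fset lattice}})
    (U : displacements R T) : stretch_map R T U = stretch U.
Proof. exact: lfunE. Qed.

Lemma stretchE (R : realType) (T : {fset {fset lattice}})
    (U : displacements R T) (i j : vertices T) (e : edges T) :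
  val e = [fset val i; val j] ->
  stretch U e = dot (pt R (val i) - pt R (val j)) (U i - U j).
Proof.
move=> eij; rewrite ffunE /=.
have e2 : #|` val e| = 2.
  have /bigfcupP[t _] : val e \in edges T by exact: valP.
  by rewrite !inE /= => /andP[_ /eqP].
have : i != j.
  apply/eqP => ij; move: e2; rewrite eij ij.
  by rewrite fsetUid cardfs1.
have : uniq (enum_fset (val e)) by exact: fset_uniq.
have mem x : (x \in enum_fset (val e)) = (x == val i) || (x == val j).
  by have -> : (x \in enum_fset (val e)) = (x \in val e) by []; rewrite eij !inE.
move: e2 mem; rewrite cardfE -?cardfE.
case: (enum_fset (val e)) => [|x [|y [|z s]]] //= _ mem /andP[].
rewrite !inE => xy _ ij.
have := mem x; have := mem y; rewrite !inE !eqxx orbT /=.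
move=> /esym/orP[]/eqP yE /esym/orP[]/eqP xE; move: xy; rewrite xE yE ?eqxx //.
- by move=> _; rewrite !at_in -dotNN !opprB.
- by move=> _; rewrite !at_in.
Qed.

Lemma comp_linear (R : realType) (T : {fset {fset lattice}}) :
  linear (@comp_stretch R T).
Proof. by move=> a phi psi; rewrite /comp_stretch comp_lfunDl comp_lfunZl. Qed.

HB.instance Definition _ (R : realType) (T : {fset {fset lattice}}) :=
  GRing.isLinear.Build R 'Hom(elongations R T, R^o) 'Hom(displacements R T, R^o)
    _ (@comp_stretch R T) (@comp_linear R T).

Lemma mem_compat (R : realType) (T : {fset {fset lattice}})
    (phi : 'Hom(elongations R T, R^o)) :
  phi \in compat R T <-> (forall U, phi (stretch_map R T U) = 0).
Proof.
rewrite memv_ker lfunE /=; split => [/eqP/lfunP h U|h].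
  by have := h U; rewrite comp_lfunE zero_lfunE.
by apply/eqP/lfunP => U; rewrite comp_lfunE zero_lfunE h.
Qed.

Lemma wagon_linear (R : realType) (T : {fset {fset lattice}}) (p : lattice) :
  linear (@wagon_fun R T p).
Proof.
move=> a f g; rewrite /wagon_fun scalerBr !scaler_sumr addrACA -opprD.
rewrite -!big_split /=; congr (_ - _); apply: eq_bigr => i _;
by rewrite /elong (at_linear (W := R^o)).
Qed.

HB.instance Definition _ (R : realType) (T : {fset {fset lattice}})
    (p : lattice) :=
  GRing.isLinear.Build R (elongations R T) R^o _ (@wagon_fun R T p)
    (@wagon_linear R T p).

Lemma wagonE (R : realType) (T : {fset {fset lattice}}) (p : lattice)
    (L : elongations R T) :
  wagon R T p L = \sum_(i < 6) elong L (nbr p i) (nbr p (ordS i))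
                  - \sum_(i < 6) elong L p (nbr p i).
Proof. exact: lfunE. Qed.

(* Main.v *)
(* A self-stress of the truss (a functional vanishing on the range of A) is the
   second difference of a discrete Airy function a on the lattice: on the edge
   pq of the triangles pqr and pqs it equals a(r) + a(s) - a(p) - a(q), which is
   the coefficient of that edge in the sum of a(x) times the wagon wheel at x.
   Wherever an edge is absent, a extends affinely across it.  Likewise an
   infinitesimal flex that vanishes on a triangle vanishes on every triangle of
   the truss adjacent to it.  Both propagations stop only at edges of the
   boundary of T, and the boundary of T is minimal: a set S of triangles with
   boundary edges among those of T is empty or T.  Hence a is zero off the
   interior vertices (the wagon wheels span the compatibility conditions) and
   the flexes are the rigid motions (c is the Maxwell number).
   Minimality comes from the topology: if an edge of the boundary of T is not
   one of S, cutting the curve at its midpoint parametrizes what is left by an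
   interval.  The vertex of the boundary of S with the largest parameter has,
   by parity, two boundary edges; by the intermediate value theorem one of them
   passes through the other end of the other one, which is absurd. *)

From HB Require Import structures.
Require Import Defs.
From mathcomp Require Import all_boot all_order all_algebra finmap.
From mathcomp Require Import all_classical all_reals all_analysis.
From mathcomp Require Import zify ring lra.
Import Order.TTheory GRing.Theory Num.Theory.
Import numFieldNormedType.Exports.
Set Implicit Arguments.
Unset Strict Implicit.
Unset Printing Implicit Defensive.
Local Open Scope fset_scope.
Local Open Scope ring_scope.

(** * Triangles and coordinates *)

(** Every triangle has three such names, one for each of its vertices; [tri_rot] passes between
    them. *)
Definition tri (p : lattice) (i : 'I_6) : {fset lattice} :=
  [fset p; nbr p i; nbr p (ordS i)].

Lemma ord6P (P : 'I_6 -> Prop) :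
  P (inord 0) -> P (inord 1) -> P (inord 2) -> P (inord 3) -> P (inord 4) ->
  P (inord 5) -> forall i, P i.
Proof.
move=> h0 h1 h2 h3 h4 h5 i.
by have := ltn_ord i; rewrite -[i in P i]inord_val;
  case: (val i) => [|[|[|[|[|[|]]]]]].
Qed.

Section Coordinates.
Variable R : realType.
Implicit Types x y u v : 'rV[R]_2.

(* The coordinates of x in the basis e1, e2. *)
Definition ca x : R := x 0 0 - x 0 1 / Num.sqrt 3.
Definition cb x : R := x 0 1 * 2 / Num.sqrt 3.

Lemma sqrt3_neq0 : Num.sqrt 3 != 0 :> R.
Proof. by rewrite sqrtr_eq0 -ltNge. Qed.

Lemma sqrt3_sqr : Num.sqrt 3 * Num.sqrt 3 = 3 :> R.
Proof. by rewrite -expr2 sqr_sqrtr. Qed.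

Lemma caD x y : ca (x + y) = ca x + ca y.
Proof. by rewrite /ca !mxE; ring. Qed.
Lemma cbD x y : cb (x + y) = cb x + cb y.
Proof. by rewrite /cb !mxE; ring. Qed.
Lemma caN x : ca (- x) = - ca x.
Proof. by rewrite /ca !mxE; ring. Qed.
Lemma cbN x : cb (- x) = - cb x.
Proof. by rewrite /cb !mxE; ring. Qed.
Lemma caZ c x : ca (c *: x) = c * ca x.
Proof. by rewrite /ca !mxE; ring. Qed.
Lemma cbZ c x : cb (c *: x) = c * cb x.
Proof. by rewrite /cb !mxE; ring. Qed.

Lemma ca_pt p : ca (pt R p) = p.1%:~R.
Proof. by have := sqrt3_neq0; rewrite /ca !mxE /= => ?; field. Qed.
Lemma cb_pt p : cb (pt R p) = p.2%:~R.
Proof. by have := sqrt3_neq0; rewrite /cb !mxE /= => ?; field. Qed.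

Definition coordE := (caD, cbD, caN, cbN, caZ, cbZ, ca_pt, cb_pt).

Lemma coord_inj x y : ca x = ca y -> cb x = cb y -> x = y.
Proof.
move=> ha hb; have s0 := sqrt3_neq0.
have h1 : x 0 1 = y 0 1.
  by move: hb; rewrite /cb -!mulrA => /mulIf; apply;
    rewrite mulf_neq0 ?invr_eq0.
have h0 : x 0 0 = y 0 0 by move: ha; rewrite /ca h1 => /addIr.
apply/rowP; case=> [[|[|//]] j]; first by congr (_ = _): h0; congr (_ _ _);
  apply: val_inj.
by congr (_ = _): h1; congr (_ _ _); apply: val_inj.
Qed.

(** The Gram matrix of the basis: unit vectors at an angle of 60 degrees, with inner product 1/2. *)
Lemma dot_coord u v :
  dot u v = ca u * ca v + cb u * cb v + (ca u * cb v + cb u * ca v) / 2.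
Proof.
have s0 := sqrt3_neq0; have s3 := sqrt3_sqr.
rewrite /dot big_ord_recl big_ord1 /ca /cb.
have -> : lift ord0 ord0 = 1 :> 'I_2 by apply: val_inj.
set a := u 0 0; set b := u 0 1; set c := v 0 0; set d := v 0 1.
set s := Num.sqrt 3 in s0 s3 *.
transitivity (a * c + b * d * (s * s) * (s^-1 * s^-1)).
  by field.
by rewrite s3; field.
Qed.
End Coordinates.

(* A unit triangle is a set k <= a <= k + 1, l <= b <= l + 1,
   m <= a + b <= m + 1 in the coordinates a, b, with m = k + l or k + l + 1;
   [slab_at p i] is the triple (k, l, m) of [tri p i]. *)
Definition slab (i : 'I_6) : int * int * int :=
  nth (0, 0, 0) [:: (0, 0, 0); (-1, 0, 0); (-1, 0, -1); (-1, -1, -1);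
                    (0, -1, -1); (0, -1, 0)] i.

Definition slab_tri (k l m : int) : {fset lattice} :=
  if m == k + l then [fset (k, l); (k + 1, l); (k, l + 1)]
  else [fset (k + 1, l); (k, l + 1); (k + 1, l + 1)].

Definition slab_at (p : lattice) (i : 'I_6) : int * int * int :=
  (p.1 + (slab i).1.1, p.2 + (slab i).1.2, p.1 + p.2 + (slab i).2).

Lemma ordS6E (i : 'I_6) : ordS i = inord (i.+1 %% 6).
Proof. by apply: val_inj; rewrite /= inordK // ltn_mod. Qed.

(** The vertex set depends on the slab triple alone, so that equality of triangles reduces to
    integer arithmetic. *)
Lemma tri_slab p i :
  tri p i = slab_tri (slab_at p i).1.1 (slab_at p i).1.2 (slab_at p i).2.
Proof.
case: p => k l; apply/fsetP => -[m n]; move: i; apply: ord6P;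
rewrite /tri /slab_tri /slab_at /nbr /slab !ordS6E ?inordK //=;
rewrite ?addr0; case: eqP => ?; try lia; rewrite !inE !xpair_eqE /=; lia.
Qed.

Definition dir (i : 'I_6) : lattice :=
  [:: (1, 0); (0, 1); (-1, 1); (-1, 0); (0, -1); (1, -1)]`_i.

Lemma nbrE p i : nbr p i = (p.1 + (dir i).1, p.2 + (dir i).2).
Proof. by []. Qed.

Lemma nbr_neq p i : nbr p i != p.
Proof.
by case: p => k l; rewrite nbrE xpair_eqE /dir; move: i; apply: ord6P;
  rewrite inordK //=; lia.
Qed.

Lemma nbr_inj p : injective (nbr p).
Proof.
move=> i j /eqP; rewrite !nbrE xpair_eqE /= => h; apply/eqP; rewrite -val_eqE.
by move: i j h; apply: ord6P; apply: ord6P; rewrite /dir /= !inordK //=; lia.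
Qed.

Lemma ordS_neq (i : 'I_6) : ordS i != i.
Proof. by rewrite -val_eqE; move: i; apply: ord6P; rewrite /= inordK. Qed.

Lemma sum_fset3 (V : nmodType) (K : choiceType) (a b c : K) (F : K -> V) :
  a != b -> a != c -> b != c ->
  \sum_(x <- [fset a; b; c]) F x = F a + F b + F c.
Proof.
move=> ab ac bc; rewrite (perm_big [:: a; b; c]) /=; last first.
  apply: uniq_perm; first exact: fset_uniq.
    by rewrite /= !inE negb_or ab ac bc.
  by move=> x; rewrite !inE orbA.
by rewrite !big_cons big_nil addr0 addrA.
Qed.

(** * Triangles as convex hulls, with disjoint interiors *)

Section Hulls.
Variable R : realType.

(** The point with barycentric coordinates 1 - a - b, a, b. *)
Definition tri_pt (p : lattice) (i : 'I_6) (a b : R) : 'rV[R]_2 :=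
  pt R p + a *: (pt R (nbr p i) - pt R p)
  + b *: (pt R (nbr p (ordS i)) - pt R p).

Lemma hull_triP p i x : hull R (tri p i) x <->
  exists a b, [/\ 0 <= a, 0 <= b, a + b <= 1 & x = tri_pt p i a b].
Proof.
have d1 : p != nbr p i by rewrite eq_sym nbr_neq.
have d2 : p != nbr p (ordS i) by rewrite eq_sym nbr_neq.
have d3 : nbr p i != nbr p (ordS i).
  by rewrite (inj_eq (@nbr_inj p)) eq_sym ordS_neq.
split=> [[w [w0]]|[a [b [a0 b0 ab ->]]]].
  rewrite !sum_fset3 // => ws ->.
  exists (w (nbr p i)), (w (nbr p (ordS i))).
  have wp : 0 <= w p by apply: w0; rewrite !inE eqxx.
  split; [by apply: w0; rewrite !inE eqxx orbT|by apply: w0;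
    rewrite !inE eqxx !orbT|lra|].
  have -> : w p = 1 - w (nbr p i) - w (nbr p (ordS i)) by lra.
  by apply: coord_inj; rewrite !coordE; ring.
exists (fun q => if q == p then 1 - a - b else if q == nbr p i then a else b).
  split; first by move=> q _; case: ifP => _; [lra|case: ifP].
  rewrite sum_fset3 // !eqxx (negPf (nbr_neq _ _)) (negPf (nbr_neq _ _)).
  by rewrite eq_sym (negPf d3); ring.
rewrite sum_fset3 // !eqxx (negPf (nbr_neq _ _)) (negPf (nbr_neq _ _)).
by rewrite eq_sym (negPf d3); apply: coord_inj; rewrite !coordE; ring.
Qed.

(** Relative to the lower ends of the slabs, each of the three coordinates is a barycentric
    coordinate or one minus it. *)
Lemma tri_pt_slab p i a b : 0 <= a -> 0 <= b -> a + b <= 1 ->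
  let x := tri_pt p i a b in let: (k, l, m) := slab_at p i in
  [/\ k%:~R <= ca x <= k%:~R + 1, l%:~R <= cb x <= l%:~R + 1
    & m%:~R <= ca x + cb x <= m%:~R + 1].
Proof.
move=> a0 b0 ab; rewrite /slab_at /tri_pt !coordE !nbrE /slab /dir ordS6E.
move: i; apply: ord6P; rewrite !inordK //= ?inordK //= !rmorphD /=;
by split; lra.
Qed.

Lemma tri_pt_slab_lt p i a b : 0 < a -> 0 < b -> a + b < 1 ->
  let x := tri_pt p i a b in let: (k, l, m) := slab_at p i in
  [/\ k%:~R < ca x < k%:~R + 1, l%:~R < cb x < l%:~R + 1
    & m%:~R < ca x + cb x < m%:~R + 1].
Proof.
move=> a0 b0 ab; rewrite /slab_at /tri_pt !coordE !nbrE /slab /dir ordS6E.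
move: i; apply: ord6P; rewrite !inordK //= ?inordK //= !rmorphD /=;
by split; lra.
Qed.

Lemma slab_uniq (k k' : int) (x : R) :
  k%:~R < x < k%:~R + 1 -> k'%:~R <= x <= k'%:~R + 1 -> k' = k.
Proof.
move=> /andP[h1 h2] /andP[h3 h4].
have : (k' < k + 1)%R by rewrite -(ltr_int R) rmorphD /=; lra.
have : (k < k' + 1)%R by rewrite -(ltr_int R) rmorphD /=; lra.
lia.
Qed.

(** An interior point lies strictly inside its three slabs, and strictly between consecutive
    integers only one slab is possible; hence the slab triples agree. *)
Lemma open_tri_disjoint p i q j a b : 0 < a -> 0 < b -> a + b < 1 ->
  hull R (tri q j) (tri_pt p i a b) -> tri q j = tri p i.
Proof.
move=> a0 b0 ab /hull_triP[c [d [c0 d0 cd e]]].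
have := tri_pt_slab_lt p i a0 b0 ab; have := tri_pt_slab q j c0 d0 cd.
rewrite !tri_slab; case: (slab_at p i) => [[k l] m].
case: (slab_at q j) => [[k' l'] m'] /=; rewrite -e => -[h1 h2 h3] [h4 h5 h6].
by rewrite (slab_uniq h4 h1) (slab_uniq h5 h2) (slab_uniq h6 h3).
Qed.

Lemma continuous_line (x u : 'rV[R]_2) : continuous (fun s : R => x + s *: u).
Proof.
by move=> s; apply: cvgD; [exact: cvg_cst|apply: cvgZr_tmp; exact: cvg_id].
Qed.

(** Moving from x toward the barycenter of the missing triangle enters its open interior at once,
    where no other triangle reaches. *)
Lemma not_interior (T : {fset {fset lattice}}) p i x :
  (forall t, t \in T -> exists q j, t = tri q j) ->
  tri p i \notin T -> hull R (tri p i) x -> ~ interior (region R T) x.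
Proof.
move=> hT pT /hull_triP[a [b [a0 b0 ab xE]]] /nbhs_ballP xint.
pose y (s : R) := x + s *: (tri_pt p i (1 / 3) (1 / 3) - x).
have yc : continuous y by exact: continuous_line.
have : nbhs (y 0) (region R T).
  by rewrite /y scale0r addr0; apply/nbhs_ballP.
move=> /(yc 0) /nbhs_ballP[e /= e0 he].
(* Small enough to stay in the neighborhood, and below 1 so that the new barycentric coordinates are
   positive combinations. *)
pose s := Num.min (e / 2) (1 / 2).
have e0' : 0 < e by [].
have s0 : 0 < s by rewrite lt_min; apply/andP; split; lra.
have s1 : s < 1 by rewrite gt_min; apply/orP; right; lra.
have se : s < e by rewrite gt_min; apply/orP; left; lra.
have : region R T (y s).
  by apply: he; rewrite /ball /= sub0r normrN gtr0_norm.
move=> [t /= tT]; have [q [j tE]] := hT _ tT; rewrite tE.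
have -> : y s = tri_pt p i (a + s * (1 / 3 - a)) (b + s * (1 / 3 - b)).
  by rewrite /y xE; apply: coord_inj; rewrite !coordE; ring.
move=> /open_tri_disjoint h; move: pT; rewrite -h ?tE -?tE ?tT //; nra.
Qed.
End Hulls.

(* The edge from p to [nbr p (ordS i)] lies between [tri p i] and
   [tri p (ordS i)]. *)
Definition boundary_edge (S : {fset lattice} -> bool) (p : lattice) (i : 'I_6)
  : bool :=
  S (tri p i) (+) S (tri p (ordS i)).

(** * Interior vertices and boundary segments of the region *)

Section Region.
Variable R : realType.

Lemma unit_quad p q : eucl_norm (pt R p - pt R q) = 1 ->
  let a := p.1 - q.1 in let b := p.2 - q.2 in a * a + b * b + a * b = 1.
Proof.
move=> h a b; have {h} : dot (pt R p - pt R q) (pt R p - pt R q) = 1.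
  rewrite -[LHS]sqr_sqrtr; first by rewrite -/(eucl_norm _) h expr1n.
  by apply: sumr_ge0 => j _; rewrite -expr2 sqr_ge0.
rewrite dot_coord !coordE /= => h; apply: (@intr_inj R).
by rewrite !(rmorphD, rmorphM, rmorphN) /= -[RHS]h; field.
Qed.

(** The quadratic form of [unit_quad] takes the value 1 at six integer points only. *)
Lemma unit_nbr p q : eucl_norm (pt R p - pt R q) = 1 -> exists i, q = nbr p i.
Proof.
case: p q => k l [m n] /unit_quad /=; set a := k - m; set b := l - n => h.
have ha : -1 <= a <= 1 by nia.
have hb : -1 <= b <= 1 by nia.
have : [|| (a == -1) && (b == 0), (a == 0) && (b == -1), (a == 1) && (b == -1),
   (a == 1) && (b == 0), (a == 0) && (b == 1) | (a == -1) && (b == 1)] by nia.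
rewrite /a /b => /or4P[H|H|H|/or3P[]H]; [exists (inord 0) | exists (inord 1)
  | exists (inord 2) | exists (inord 3) | exists (inord 4) | exists (inord 5)];
by apply/eqP; rewrite nbrE xpair_eqE /dir inordK //=; lia.
Qed.

Lemma unit_triangle_tri t : unit_triangle R t -> exists p i, t = tri p i.
Proof.
move=> [t3 h]; have : size (enum_fset t) = 3 by [].
have tE x : (x \in t) = (x \in enum_fset t) by [].
have := fset_uniq t; case E : (enum_fset t) => [|p [|q [|r []]]] //=.
rewrite !inE negb_or => /andP[/andP[pq pr] /andP[qr _]] _.
have tp : p \in t by rewrite tE E !inE eqxx.
have tq : q \in t by rewrite tE E !inE eqxx orbT.
have tr : r \in t by rewrite tE E !inE eqxx !orbT.
have [i qE] := unit_nbr (h _ _ tp tq pq).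
have [j rE] := unit_nbr (h _ _ tp tr pr).
(* Two neighbors of p are at distance 1 from each other only if they are cyclically consecutive. *)
have : (j == ordS i) || (i == ordS j).
  have := unit_quad (h _ _ tq tr qr); move: qr;
    rewrite qE rE !nbrE /= xpair_eqE.
  rewrite !ordS6E /dir -!val_eqE; move: i j {qE rE}.
  by apply: ord6P; apply: ord6P; rewrite /= !inordK //=; lia.
case/orP => /eqP ij; [exists p, i | exists p, j]; apply/fsetP => x;
  rewrite tE E /tri -ij -qE -rE !inE -?orbA //.
by case: (x == p); case: (x == q); case: (x == r).
Qed.

(** The signs of a, b and a + b tell in which of the six sectors at p the point lies; the bounds 1/2
    keep it on the near side of the rim of the hexagon. *)
Lemma sector (p : lattice) (x : 'rV[R]_2) :
  let a := ca x - ca (pt R p) in let b := cb x - cb (pt R p) in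
  -1 / 2 < a < 1 / 2 -> -1 / 2 < b < 1 / 2 -> exists i, hull R (tri p i) x.
Proof.
move=> a b ha hb.
suff [i [c [d [c0 d0 cd e1 e2]]]] : exists i c d, [/\ 0 <= c, 0 <= d, c + d <=
  1,
    a = c * (dir i).1%:~R + d * (dir (ordS i)).1%:~R
  & b = c * (dir i).2%:~R + d * (dir (ordS i)).2%:~R].
  exists i; apply/hull_triP; exists c, d; split => //.
  apply: coord_inj; rewrite /tri_pt !coordE !nbrE /= !rmorphD /=.
    by move: e1; rewrite /a coordE => e1; lra.
  by move: e2; rewrite /b coordE => e2; lra.
have [a0|a0] := lerP 0 a; have [b0|b0] := lerP 0 b.
- by exists (inord 0), a, b; rewrite ordS6E /dir !inordK //=; split; lra.
- have [ab|ab] := lerP 0 (a + b).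
  + by exists (inord 5), (- b), (a + b); rewrite ordS6E /dir !inordK //=;
      split; lra.
  + by exists (inord 4), (- a - b), a; rewrite ordS6E /dir !inordK //=; split;
      lra.
- have [ab|ab] := lerP 0 (a + b).
  + by exists (inord 1), (a + b), (- a); rewrite ordS6E /dir !inordK //=;
      split; lra.
  + by exists (inord 2), b, (- a - b); rewrite ordS6E /dir !inordK //=; split;
      lra.
- by exists (inord 3), (- a), (- b); rewrite ordS6E /dir !inordK //=; split;
    lra.
Qed.

Lemma continuous_ca : continuous (@ca R).
Proof.
have c (j : 'I_2) : continuous (fun x : 'rV[R]_2 => x 0 j).
  exact: coord_continuous.
by move=> x; exact: (cvgB (c 0 x) (cvgMr_tmp (c 1 x))).
Qed.

Lemma continuous_cb : continuous (@cb R).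
Proof.
have c (j : 'I_2) : continuous (fun x : 'rV[R]_2 => x 0 j).
  exact: coord_continuous.
by move=> x; exact: (cvgMr_tmp (cvgMr_tmp (c 1 x))).
Qed.

Lemma mem_tri p i : p \in tri p i.
Proof. by rewrite !inE eqxx. Qed.

Lemma hull_vertex (s : {fset lattice}) p : p \in s -> hull R s (pt R p).
Proof.
move=> ps; exists (fun q => (q == p)%:R).
  split=> [q _|]; first by case: (q == p).
  rewrite (big_fsetD1 p) //= eqxx big1_fset ?addr0 // => q.
  by rewrite !inE => /andP[/negPf->].
rewrite (big_fsetD1 p) //= eqxx scale1r big1_fset ?addr0 // => q.
by rewrite !inE => /andP[/negPf->]; rewrite scale0r.
Qed.

Lemma mem_vertices (T : {fset {fset lattice}}) p :
  reflect (exists2 t, t \in T & p \in t) (p \in vertices T).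
Proof.
apply: (iffP idP) => [/bigfcupP[t /andP[tT _] pt]|[t tT pt]]; first by exists t.
by apply/bigfcupP; exists t; rewrite ?tT.
Qed.

(** This trades topology for combinatorics: a missing triangle at p is excluded by [not_interior],
    and six triangles fill a neighborhood by [sector]. *)
Lemma interior_verticesP (T : {fset {fset lattice}}) p :
  (forall t, t \in T -> exists q j, t = tri q j) ->
  reflect (forall i, tri p i \in T) (p \in interior_vertices R T).
Proof.
move=> hT; rewrite !inE; apply: (iffP andP) => [[_ /asboolP pint] i|h].
  apply: contraPT pint => /(not_interior hT); apply.
  exact/hull_vertex/mem_tri.
split; first by apply/mem_vertices; exists (tri p (inord 0));
  rewrite ?h ?mem_tri.
apply/asboolP.
have half0 : (1 / 2 : R) > 0 by [].
have na : \forall x \near pt R p, `|ca x - ca (pt R p)| < 1 / 2.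
  exact: (@cvgr_distC_lt _ _ _ _ _ _ _ (@continuous_ca (pt R p)) _ half0).
have nb : \forall x \near pt R p, `|cb x - cb (pt R p)| < 1 / 2.
  exact: (@cvgr_distC_lt _ _ _ _ _ _ _ (@continuous_cb (pt R p)) _ half0).
rewrite /interior; near=> x.
have [] := @sector p x.
- have : `|ca x - ca (pt R p)| < 1 / 2 by near: x.
  by rewrite ltr_norml => /andP[? ?]; apply/andP; split; lra.
- have : `|cb x - cb (pt R p)| < 1 / 2 by near: x.
  by rewrite ltr_norml => /andP[? ?]; apply/andP; split; lra.
- by move=> i xi; exists (tri p i) => //=.
Unshelve. all: by end_near. Qed.

(** The segment lies in a triangle of T, hence in the closure, and in a triangle outside T, hence
    off the interior. *)
Lemma boundary_edge_sub (T : {fset {fset lattice}}) p i (s : R) :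
  (forall t, t \in T -> exists q j, t = tri q j) ->
  boundary_edge (fun t => t \in T) p i -> 0 <= s <= 1 ->
  boundary (region R T) (pt R p + s *: (pt R (nbr p (ordS i)) - pt R p)).
Proof.
move=> hT /= pi /andP[s0 s1]; set x := _ + _.
have h1 : hull R (tri p i) x.
  apply/hull_triP; exists 0, s; split => //; first by rewrite add0r.
  by rewrite /tri_pt scale0r addr0.
have h2 : hull R (tri p (ordS i)) x.
  apply/hull_triP; exists s, 0; split => //; first by rewrite addr0.
  by rewrite /tri_pt scale0r addr0.
split.
  apply: subset_closure; move: pi; rewrite /boundary_edge.
  by case: (boolP (tri p i \in T)) => [iT _|_ /= iT];
    [exists (tri p i)|exists (tri p (ordS i))].
move: pi; rewrite /boundary_edge /=;
  case: (boolP (tri p i \in T)) => [_ /= iT|iT _];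
exact: not_interior iT _.
Qed.
End Region.

(** * The boundary curve *)

Section Curve.
Variable R : realType.

(* t is the inverse of the parametrization, started at x0.  It is continuous
   along c because the parametrization maps compact sets to closed sets. *)
Lemma simple_closed_curve_cut (C : set 'rV[R]_2) (x0 : 'rV[R]_2) :
  simple_closed_curve R C -> C x0 ->
  exists t : 'rV[R]_2 -> R,
    {in C &, injective t} /\
    forall c : R -> 'rV[R]_2, continuous c ->
      (forall s, 0 <= s <= 1 -> C (c s) /\ c s <> x0) ->
      forall v, Num.min (t (c 0)) (t (c 1)) <= v <= Num.max (t (c 0)) (t (c 1))
        ->
      exists2 s, 0 <= s <= 1 & t (c s) = v.
Proof.
move=> [g [gc g01 ginj gC]] Cx0.
have par x : exists s, C x -> 0 <= s < 1 /\ g s = x.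
  have [Cx|nCx] := pselect (C x); last by exists 0.
  move: (Cx); rewrite -gC => -[s /=]; rewrite in_itv /= => /andP[s0 s1] sx.
  have [s1'|s1'] := ltrP s 1; first by exists s; rewrite s0 s1'.
  exists 0 => _; rewrite lexx ltr01; split => //.
  by rewrite g01 -sx; congr g; lra.
have [p pP] := choice par.
have [/andP[t0 t1] gt] := pP _ Cx0.
set a := p x0 in t0 t1 gt.
(* Parameters up to [a] are raised by 1, so t takes values in ]a, a + 1]. The seam of the
   parametrization is moved to [x0], where t is a + 1. *)
exists (fun x => if a < p x then p x else p x + 1); split.
  move=> x y /[!inE] Cx Cy.
  have [/andP[px0 px1] gx] := pP _ Cx; have [/andP[py0 py1] gy] := pP _ Cy.
  move=> txy; suff e : p x = p y by rewrite -gx e.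
  by move: txy; have [?|?] := ltrP a (p x); have [?|?] := ltrP a (p y); lra.
move=> c cc cC v vP.
set f := fun s => (if a < p (c s) then p (c s) else p (c s) + 1).
suff fc : {within `[0, 1], continuous f}%classic.
  have [s s01 <-] := IVT (@ler01 R) fc vP.
  by exists s => //; move: s01; rewrite in_itv.
have cptg (A : set R) : closed A -> closed (g @` (`[0, 1] `&` A))%classic.
  move=> cA; apply: compact_closed; first exact: norm_hausdorff.
  apply: continuous_compact.
    by apply: continuous_subspaceW gc => x [].
  by apply: compact_closedI => //; exact: segment_compact.
apply/continuous_closedP => A cA; apply/closed_subspaceP.
(* Along [c], the preimage of [A] under [f] is cut out by the images of two closed parameter sets,
   one for each branch of [f]. Their common end [a] is harmless because [c] avoids [x0]. *)
pose A1 := (`[a, 1] `&` A)%classic.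
pose A2 := (`[0, a] `&` ((fun x : R => x + 1) @^-1` A))%classic.
exists (c @^-1` (g @` (`[0, 1] `&` A1) `|` g @` (`[0, 1] `&` A2)))%classic.
  move/continuous_closedP: cc; apply; apply: closedU; apply: cptg.
    by apply: closedI => //; exact: itv_closed.
  apply: closedI; first exact: itv_closed.
  have : continuous (fun x : R => x + 1).
    by move=> x; apply: cvgD; [exact: cvg_id|exact: cvg_cst].
  by move/continuous_closedP; apply.
apply/seteqP; split => s [/= h s01]; split => //; move: (s01);
  rewrite /= in_itv /= => s01'; have [Cs ns] := cC _ s01';
  have [/andP[p0 p1] gp] := pP _ Cs.
- change (A (f s)); rewrite /f; have na : p (c s) <> a by move=> e; apply: ns;
    rewrite -gp e.
  move: h; rewrite /A1 /A2 => -[] [r [/= + [/= + +]]];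
    rewrite !in_itv /= => /andP[r0 r1] /andP[r2 r3] Ar gr.
    have [r1'|r1'] := ltrP r 1.
      have e : r = p (c s) by apply: ginj; rewrite ?r0 ?p0 // gp.
      rewrite -e ifT // lt_def r2 andbT; apply/eqP => e'; apply: na; lra.
    (* The parameter 1 gives the point [g 0], whose chosen parameter is 0; [f] raises it back to
       1. *)
    have e1 : r = 1 by lra.
    have e : p (c s) = 0.
      by apply: ginj; rewrite ?p0 ?lexx ?ltr01 // gp g01 -e1.
    rewrite e add0r ifF; first by rewrite -e1.
    by apply/negbTE; rewrite -leNgt.
  have e : r = p (c s) by apply: ginj; rewrite ?r0 ?p0 //= ?gp //; lra.
  by rewrite -e ifF //; apply/negbTE; rewrite -leNgt.
- change (A (f s)) in h; rewrite /f in h; case: ifP h => pa Ah; [left|right];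
    exists (p (c s)) => //.
    by rewrite /A1 /= !in_itv /= ; split; [lra|split => //; lra].
  by rewrite /A2 /= !in_itv /=; move/negbT: pa; rewrite -leNgt => pa; split;
    [lra|split => //; lra].
Qed.
End Curve.

(** * Combinatorics of the triangles around a vertex *)

Lemma ordS2_neq (i : 'I_6) : ordS (ordS i) != i.
Proof. by rewrite -val_eqE; move: i; apply: ord6P; rewrite /= inordK. Qed.

Lemma tri_neq p i : tri p i != tri p (ordS i).
Proof.
apply/negP => /eqP/fsetP/(_ (nbr p i)); rewrite !inE !(inj_eq (@nbr_inj p)).
rewrite !eqxx orbT (negPf (nbr_neq _ _)) eq_sym (negPf (ordS_neq _)) /=.
by rewrite eq_sym (negPf (ordS2_neq _)).
Qed.

Lemma slab_tri_eq p i q j : slab_at p i == slab_at q j -> tri p i = tri q j.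
Proof. by move=> /eqP e; rewrite !tri_slab e. Qed.

(** Reversing an edge adds three to its direction and exchanges the triangles on its two sides. *)
Lemma tri_flip p i : let q := nbr p (ordS i) in let j := ordS (ordS (ordS i)) in
  tri q j = tri p (ordS i) /\ tri q (ordS j) = tri p i.
Proof.
by case: i => [[|[|[|[|[|[|//]]]]]] ?]; split; apply: slab_tri_eq;
  rewrite /slab_at !xpair_eqE nbrE /slab /dir /=; lia.
Qed.

Lemma tri_shift p : tri (nbr p (inord 0)) (inord 2) = tri p (inord 0).
Proof.
by apply: slab_tri_eq;
  rewrite /slab_at !xpair_eqE nbrE /slab /dir !inordK //=; lia.
Qed.

Lemma boundary_edge_flip S p i :
  boundary_edge S (nbr p (ordS i)) (ordS (ordS (ordS i))) = boundary_edge S p i.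
Proof. by rewrite /boundary_edge; have [-> ->] := tri_flip p i;
  rewrite addbC. Qed.

Lemma iter_ordS_val n (i : 'I_6) : iter n (@ordS 6) i = ((i + n) %% 6)%N :> nat.
Proof.
elim: n => [|n IHn] /=; first by rewrite addn0 modn_small.
by rewrite IHn -addn1 modnDml addn1 addnS.
Qed.

(* Around p, membership in S changes an even number of times. *)
Lemma boundary_edge_parity S p i : boundary_edge S p i -> exists2 j, j != i &
  boundary_edge S p j.
Proof.
move=> h; apply/exists_inP; apply: contraLR h => /exists_inPn h.
have step n : (0 < n < 6)%N ->
    S (tri p (iter n (@ordS 6) i)) = S (tri p (iter n.+1 (@ordS 6) i)).
  move=> n6; have /h : iter n (@ordS 6) i != i.
    by rewrite -val_eqE /= iter_ordS_val; have := ltn_ord i; lia.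
  by rewrite /boundary_edge /=; case: (S _); case: (S _).
have i6 : iter 6 (@ordS 6) i = i.
  by apply: ord_inj; rewrite iter_ordS_val; have := ltn_ord i; lia.
have : S (tri p (iter 1 (@ordS 6) i)) = S (tri p (iter 6 (@ordS 6) i)).
  by rewrite (step 1) // (step 2) // (step 3) // (step 4) // (step 5).
by rewrite i6 /boundary_edge /= => ->; rewrite addbb.
Qed.

Lemma segment_neighbor (R : realType) p i j (s : R) :
  pt R (nbr p i) = pt R p + s *: (pt R (nbr p j) - pt R p) -> 0 <= s -> i = j.
Proof.
move=> e s0; have := congr1 (@ca R) e; have := congr1 (@cb R) e.
rewrite !coordE !nbrE /= !rmorphD /= => e1 e2; apply/eqP; rewrite -val_eqE.
have {}e1 : (dir i).2%:~R = s * (dir j).2%:~R by lra.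
have {}e2 : (dir i).1%:~R = s * (dir j).1%:~R by lra.
move: e1 e2 {e}; case: i => [[|[|[|[|[|[|//]]]]]] ?];
  case: j => [[|[|[|[|[|[|//]]]]]] ?];
  rewrite /dir //= => e1 e2; exfalso; lra.
Qed.

Lemma half_slab (R : realType) (c k : int) (x : R) :
  k%:~R <= x <= k%:~R + 1 -> x = c%:~R / 2 -> 2 * k <= c <= 2 * k + 2.
Proof.
move=> /andP[h1 h2] xE; apply/andP; split;
  rewrite -(ler_int R) !(rmorphD, rmorphM) /=; lra.
Qed.

(** The midpoint has half-integer coordinates, so the slab conditions become integer inequalities
    that only the two triangles beside the edge satisfy. *)
Lemma midpoint_tri (R : realType) p i q j :
  hull R (tri q j) (pt R p + (1 / 2) *: (pt R (nbr p (ordS i)) - pt R p)) ->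
  tri q j = tri p i \/ tri q j = tri p (ordS i).
Proof.
set x := _ + _ => /hull_triP[a [b [a0 b0 ab xE]]].
have := tri_pt_slab q j a0 b0 ab; rewrite -xE.
have c1 : ca x = (2 * p.1 + (dir (ordS i)).1)%:~R / 2.
  by rewrite /x !coordE nbrE /= !(rmorphD, rmorphM) /=; field.
have c2 : cb x = (2 * p.2 + (dir (ordS i)).2)%:~R / 2.
  by rewrite /x !coordE nbrE /= !(rmorphD, rmorphM) /=; field.
have c3 : ca x + cb x = (2 * (p.1 + p.2) + ((dir (ordS i)).1 + (dir (ordS
  i)).2))%:~R / 2.
  by rewrite c1 c2 !(rmorphD, rmorphM) /=; field.
have mE : ((slab_at q j).2 == (slab_at q j).1.1 + (slab_at q j).1.2)
    || ((slab_at q j).2 == (slab_at q j).1.1 + (slab_at q j).1.2 + 1).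
  by case: j {xE} => [[|[|[|[|[|[|//]]]]]] ?]; rewrite /slab_at /slab /=; lia.
rewrite !(tri_slab q); case: (slab_at q j) mE => [[k l] m] /= mE.
move=> [/half_slab-/(_ _ c1) h1 /half_slab-/(_ _ c2) h2 /half_slab-/(_ _ c3)
  h3].
have : ((k, l, m) == slab_at p i) || ((k, l, m) == slab_at p (ordS i)).
  by case: i h1 h2 h3 {x xE c1 c2 c3} => [[|[|[|[|[|[|//]]]]]] ?];
    rewrite /slab_at /slab /dir /= !xpair_eqE; lia.
by rewrite !tri_slab => /orP[] /eqP <-; [left|right].
Qed.

Lemma vertices_bounded (T : {fset {fset lattice}}) :
  exists N : int, forall p, p \in vertices T -> p.1 < N /\ p.2 < N.
Proof.
exists (1 + \sum_(p <- vertices T) (`|p.1| + `|p.2|)) => p pT.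
rewrite (big_fsetD1 p) //=; set s := \sum_(_ <- _) _.
have : 0 <= s by apply: sumr_ge0 => q _; apply: addr_ge0.
by split; lia.
Qed.

Lemma tri_vertices (T : {fset {fset lattice}}) p i : tri p i \in T ->
  [/\ p \in vertices T, nbr p i \in vertices T & nbr p (ordS i) \in vertices T].
Proof.
by move=> iT; split; apply/mem_vertices; exists (tri p i);
  rewrite // !inE eqxx ?orbT.
Qed.

Lemma boundary_edge_vertices (T : {fset {fset lattice}}) p i :
  boundary_edge (fun t => t \in T) p i -> p \in vertices T.
Proof.
by rewrite /boundary_edge;
  case: (boolP (tri p i \in T)) => [/tri_vertices[]|_ /= /tri_vertices[]].
Qed.

(* S would be invariant under translation by e1. *)
Lemma no_boundary_edge (S : {fset lattice} -> bool) (N : int) :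
  (forall k l i, N <= k -> ~~ S (tri (k, l) i)) ->
  (forall p i, ~~ boundary_edge S p i) -> forall p i, ~~ S (tri p i).
Proof.
move=> SN S0; have step p i : S (tri p i) = S (tri p (ordS i)).
  by have := S0 p i; rewrite /boundary_edge; case: (S _); case: (S _).
have const p i j : S (tri p i) = S (tri p j).
  suff h i' : S (tri p i') = S (tri p ord0) by rewrite !h.
  have E n : S (tri p (iter n (@ordS 6) ord0)) = S (tri p ord0).
    by elim: n => //= n <-; rewrite -step.
  rewrite -(E i'); congr (S (tri p _)); apply: ord_inj.
  by rewrite iter_ordS_val add0n modn_small.
move=> [k l] i; have shift n : S (tri (k + n%:Z, l) i) = S (tri (k, l) i).
  elim: n => [|n <-]; first by rewrite addr0.
  have -> : (k + n.+1%:Z, l) = nbr (k + n%:Z, l) (inord 0).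
    by rewrite nbrE /dir inordK //=; congr (_, _); lia.
  rewrite [LHS](const _ i (inord 2)) tri_shift; exact: const.
by rewrite -(shift `|N - k|%N); apply: SN; lia.
Qed.

Lemma ordS_inj : injective (@ordS 6).
Proof.
move=> i j /(congr1 val) /= h; apply: ord_inj.
by have := ltn_ord i; have := ltn_ord j; lia.
Qed.

(** * Minimality of the boundary *)

Section Star.
Variables (R : realType) (T : {fset {fset lattice}}).
Hypothesis hT : forall t, t \in T -> exists q j, t = tri q j.
Hypothesis hX : simple_closed_curve R (boundary (region R T)).

Let bdT := boundary_edge (fun t => t \in T).

(** Emptiness is asked only beyond [N], because one application takes for [S] triangles outside T,
    which could a priori go on forever in other directions. *)
Lemma boundary_minimal (S : {fset lattice} -> bool) (N : int) :
  (forall k l i, N <= k -> ~~ S (tri (k, l) i)) ->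
  (forall p i, boundary_edge S p i -> bdT p i) ->
  (forall p i, ~~ S (tri p i)) \/ (forall p i, S (tri p i) = (tri p i \in T)).
Proof.
move=> SN sub.
have [[p0 [i0 [b0 nb0]]]|all] := pselect (exists p i, bdT p i /\ ~~
  boundary_edge S p i);
  last first.
  (* Here S and T have the same boundary edges, so their symmetric difference has none. *)
  have [N' hN'] := vertices_bounded T; right => p i; apply/eqP.
  rewrite -[_ == _]negbK negb_eqb.
  apply: (@no_boundary_edge (fun t => S t (+) (t \in T)) (Num.max N N')).
    move=> k l j; rewrite ge_max => /andP[Nk N'k];
      rewrite (negPf (SN _ _ _ Nk)).
    by apply/negP => /= /tri_vertices[/hN'[/= h _] _ _]; lia.
  move=> q j; have : bdT q j = boundary_edge S q j.
    by apply/idP/idP => [h|/sub//]; apply: contraPT all => h'; apply;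
      exists q, j.
  rewrite /bdT /boundary_edge.
  by case: (S _); case: (S _); case: (_ \in _); case: (_ \in _).
left; apply: (no_boundary_edge SN) => p1 i1; apply/negP => b1.
pose seg p i (s : R) := pt R p + s *: (pt R (nbr p (ordS i)) - pt R p).
have segC p i s : bdT p i -> 0 <= s <= 1 -> boundary (region R T) (seg p i s).
  exact: boundary_edge_sub.
pose x0 := seg p0 i0 (1 / 2).
(* Both triangles beside a segment through [x0] contain this midpoint, so they are the two beside
   the cut edge, which S does not separate. *)
have segx0 p i s : boundary_edge S p i -> 0 <= s <= 1 -> seg p i s <> x0.
  move=> bi /andP[s0 s1] e; move: nb0; apply/negP/negPn.
  have h1 : hull R (tri p i) x0.
    rewrite -e; apply/hull_triP; exists 0, s; split => //;
      first by rewrite add0r.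
    by rewrite /tri_pt scale0r addr0.
  have h2 : hull R (tri p (ordS i)) x0.
    rewrite -e; apply/hull_triP; exists s, 0; split => //;
      first by rewrite addr0.
    by rewrite /tri_pt scale0r addr0.
  have := tri_neq p i; move: bi; rewrite /boundary_edge.
  by case: (midpoint_tri h1) => ->; case: (midpoint_tri h2) => ->;
    rewrite ?eqxx // addbC.
have Cx0 : boundary (region R T) x0 by apply: segC => //; lra.
have [t [tinj tivt]] := simple_closed_curve_cut hX Cx0.
pose V := [fset p in vertices T | [exists i, boundary_edge S p i]].
have inV p i : boundary_edge S p i -> p \in V.
  move=> b; rewrite !inE (boundary_edge_vertices (sub _ _ b)) /=;
    apply/existsP; by exists i.
have seg0 p i : seg p i 0 = pt R p by rewrite /seg scale0r addr0.
have seg1 p i : seg p i 1 = pt R (nbr p (ordS i)).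
  by rewrite /seg scale1r addrC subrK.
have [p [i bi] pmax] : exists2 p, exists i, boundary_edge S p i &
    forall q j, boundary_edge S q j -> t (pt R q) <= t (pt R p).
  have [v _ vmax] := @Order.TotalTheory.arg_maxP _ _ _ [` inV _ _ b1] predT
    (fun v : V => t (pt R (val v))) isT.
  exists (val v); first by have := valP v; rewrite !inE => /andP[_ /existsP].
  by move=> q j /inV qV; exact: (vmax [` qV] isT).
have [j ji bj] := boundary_edge_parity bi.
(* Of the two far ends, that of [i'] has its parameter between those of the far end of [j'] and of
   p. The segment toward [j'] attains this value, so by injectivity it contains the far end of
   [i']. *)
have key i' j' : i' != j' -> boundary_edge S p i' -> boundary_edge S p j' ->
    t (pt R (nbr p (ordS j'))) <= t (pt R (nbr p (ordS i'))) -> False.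
  move=> ij bi' bj' le_t.
  have [|||s /andP[s0 s1] ts] := tivt (seg p j') _ _ (t (pt R (nbr p (ordS
    i')))).
  - exact: continuous_line.
  - by move=> s s01; split; [apply: segC s01; exact: sub|exact: segx0].
  - rewrite seg0 seg1 ge_min le_max le_t orbT /=; apply/orP; left.
    (* The far end is a vertex of the boundary of S as well, through the reversed edge. *)
    by rewrite (pmax _ (ordS (ordS (ordS i')))) // boundary_edge_flip.
  have e : seg p j' s = pt R (nbr p (ordS i')).
    apply: tinj ts; rewrite inE; first by apply: segC; [exact: sub|rewrite s0].
    by rewrite -seg1; apply: segC; [exact: sub|rewrite ler01 lexx].
  have /ordS_inj ij' := segment_neighbor (esym e) s0.
  by rewrite ij' eqxx in ij.
have [le_t|/ltW le_t] := lerP (t (pt R (nbr p (ordS j)))) (t (pt R (nbr p (ordS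
  i)))).
  by apply: (key i j); rewrite // eq_sym.
exact: (key j i).
Qed.
End Star.

(** * Edges and stresses *)

Lemma fset2_eq (K : choiceType) (a b c d : K) :
  ([fset a; b] == [fset c; d]) = (a == c) && (b == d) || (a == d) && (b == c).
Proof.
apply/eqP/idP => [/fsetP h|].
  move: (h a) (h b) (h c) (h d); rewrite !inE !eqxx ?orbT /=.
  move=> /esym/orP[]/eqP ea /esym/orP[]/eqP eb /orP[]/eqP ec /orP[]/eqP ed;
    by subst; rewrite ?eqxx ?orbT.
by case/orP => /andP[/eqP-> /eqP->] //; rewrite fsetUC.
Qed.

(** Passing to the next vertex of a triangle turns the viewpoint by 120 degrees, which adds two to
    the index. *)
Lemma tri_rot p i : let q := nbr p i in let j := ordS (ordS i) in
  [/\ tri q j = tri p i, nbr q j = nbr p (ordS i) & nbr q (ordS j) = p].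
Proof.
case: p => k l; case: i => [[|[|[|[|[|[|//]]]]]] ?]; split;
  try (apply: slab_tri_eq; rewrite /slab_at !xpair_eqE nbrE /slab /dir /=; lia);
  by apply/eqP; rewrite !nbrE /dir /= xpair_eqE; lia.
Qed.

(** The three names of a triangle give its three edges in this form, the one that [boundary_edge]
    uses. *)
Lemma edgesP (T : {fset {fset lattice}}) s :
  (forall t, t \in T -> exists q j, t = tri q j) ->
  reflect (exists p i, tri p i \in T /\ s = [fset p; nbr p (ordS i)])
    (s \in edges T).
Proof.
move=> hT; apply: (iffP idP) => [/bigfcupP[t /andP[tT _]]|[p [i [iT ->]]]].
  rewrite !inE /= => /andP[st s2]; have [p [i tE]] := hT _ tT; subst t.
  have {}st : s `<=` tri p i by rewrite -fpowersetE.
  have [[r1 r2 r3] [r4 r5 r6]] := (tri_rot p i, tri_rot (nbr p i) (ordS (ordS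
    i))).
  move: r4 r5 r6; rewrite r1 r2 r3 => r4 r5 r6.
  have pairs : [\/ s = [fset p; nbr p (ordS i)], s = [fset nbr p i; p]
      | s = [fset nbr p (ordS i); nbr p i]].
    have sE x : (x \in s) = (x \in enum_fset s) by [].
    have : size (enum_fset s) == 2 by [].
    have := fset_uniq s; case E : (enum_fset s) sE => [|x [|y []]] //= sE + _.
    rewrite inE andbT => xy.
    have {E}-> : s = [fset x; y] by apply/fsetP => z; rewrite sE !inE.
    move: xy; have := fsubsetP st y; have := fsubsetP st x.
    rewrite !sE !inE !eqxx ?orbT => /(_ isT) + /(_ isT).
    move=> /orP[/orP[]|] /eqP-> /orP[/orP[]|] /eqP->; rewrite ?eqxx // => _;
      by [constructor 1|constructor 2|constructor 3|rewrite fsetUC;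
        constructor 1
         |rewrite fsetUC; constructor 2|rewrite fsetUC; constructor 3].
  case: pairs => ->; [exists p, i|exists (nbr p i), (ordS (ordS i))|
     exists (nbr p (ordS i)), (ordS (ordS (ordS (ordS i))))]; split => //.
  - by rewrite r1.
  - by rewrite r3.
  - by rewrite r4.
  - by rewrite r6.
apply/bigfcupP; exists (tri p i); rewrite ?iT // !inE /=; apply/andP; split.
  have st : [fset p; nbr p (ordS i)] `<=` tri p i.
    by apply/fsubsetP => x; rewrite !inE => /orP[]/eqP->; rewrite eqxx ?orbT.
  by rewrite -fpowersetE in st.
by rewrite cardfs2 (eq_sym p) nbr_neq.
Qed.

Lemma nbr_back p i : nbr (nbr p i) (ordS (ordS (ordS i))) = p.
Proof. by have [_ _] := tri_rot p i. Qed.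

Lemma edge_tri (T : {fset {fset lattice}}) p i :
  (forall t, t \in T -> exists q j, t = tri q j) ->
  [fset p; nbr p (ordS i)] \in edges T ->
  (tri p i \in T) || (tri p (ordS i) \in T).
Proof.
move=> hT /(edgesP _ hT)[q [j [jT /eqP]]]; rewrite fset2_eq.
case/orP=> /andP[/eqP pq /eqP nq].
  move: nq; rewrite pq => /nbr_inj/ordS_inj ->; by rewrite jT.
move: jT; rewrite -nq; have [<- _] := tri_flip p i.
suff -> : j = ordS (ordS (ordS i)) by move=> ->; rewrite orbT.
apply/ordS_inj/(@nbr_inj q); by rewrite -pq -{1}nq nbr_back.
Qed.

(** Together with [spoke_edge], this finds the wheels that see an edge: on the rim those centered at
    its two opposite vertices, as a spoke those centered at its ends. *)
Lemma rim_edge q j p i :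
  ([fset nbr q j; nbr q (ordS j)] == [fset p; nbr p (ordS i)]) =
  (q == nbr p (ordS (ordS i))) && (j == iter 5 (@ordS 6) i)
  || (q == nbr p i) && (j == iter 2 (@ordS 6) i).
Proof.
case: p q => [a b] [k l]; rewrite fset2_eq -!val_eqE !nbrE !xpair_eqE.
by case: i => [[|[|[|[|[|[|//]]]]]] ?]; case: j => [[|[|[|[|[|[|//]]]]]] ?];
  rewrite /dir /=; lia.
Qed.

Lemma spoke_edge q j p i :
  ([fset q; nbr q j] == [fset p; nbr p (ordS i)]) =
  (q == p) && (j == ordS i)
  || (q == nbr p (ordS i)) && (j == iter 4 (@ordS 6) i).
Proof.
case: p q => [a b] [k l]; rewrite fset2_eq -!val_eqE !nbrE !xpair_eqE.
by case: i => [[|[|[|[|[|[|//]]]]]] ?]; case: j => [[|[|[|[|[|[|//]]]]]] ?];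
  rewrite /dir /=; lia.
Qed.

Lemma sum_pick2 (R : nzRingType) (f : 'I_6 -> R) (c d : 'I_6) (X Y : bool) :
  c != d -> \sum_j f j * (X && (j == c) || Y && (j == d))%:R =
  X%:R * f c + Y%:R * f d.
Proof.
move=> cd; have dc : d != c by rewrite eq_sym.
rewrite (bigD1 c) //= (bigD1 d) //= big1.
  rewrite !eqxx (negPf cd) (negPf dc) !andbT !andbF orbF addr0 /=.
  by congr (_ + _); case: X; case: Y; rewrite ?mulr1 ?mulr0 ?mul1r ?mul0r.
by move=> j /andP[/negPf-> /negPf->]; rewrite !andbF mulr0.
Qed.

Lemma iter_ordS_neq m n (i : 'I_6) : (m < n < 6)%N ->
  iter m (@ordS 6) i != iter n (@ordS 6) i.
Proof.
by move=> mn; rewrite -val_eqE /= !iter_ordS_val; have := ltn_ord i; lia.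
Qed.

(** * Functionals on elongations and equilibrium at a vertex *)

Section Functionals.
Variables (R : realType) (T : {fset {fset lattice}}).
Hypothesis hT : forall t, t \in T -> exists q j, t = tri q j.

(** It is zero when [s] is not an edge, so a stress extends by zero to all pairs of lattice
    points. *)
Definition unit_elong (s : {fset lattice}) : elongations R T :=
  [ffun e => (val e == s)%:R].

Lemma elong_unit s p q : s \in edges T ->
  elong (unit_elong s) p q = ([fset p; q] == s)%:R.
Proof.
move=> sT; rewrite /elong /at_; case: insubP => [e eT <-|qT] /=;
  first by rewrite ffunE.
by case: eqVneq => // e; rewrite e sT in qT.
Qed.

Lemma wagon_unit q p i : [fset p; nbr p (ordS i)] \in edges T ->
  wagon R T q (unit_elong [fset p; nbr p (ordS i)]) =
  (q == nbr p (ordS (ordS i)))%:R + (q == nbr p i)%:R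
  - ((q == p)%:R + (q == nbr p (ordS i))%:R).
Proof.
move=> eT; rewrite wagonE; congr (_ - _).
  transitivity (\sum_(j < 6) 1 *
     ((q == nbr p (ordS (ordS i))) && (j == iter 5 (@ordS 6) i)
      || (q == nbr p i) && (j == iter 2 (@ordS 6) i))%:R : R).
    by apply: eq_bigr => j _; rewrite mul1r elong_unit // rim_edge.
  by rewrite sum_pick2 ?mulr1 // eq_sym iter_ordS_neq.
transitivity (\sum_(j < 6) 1 * ((q == p) && (j == iter 1 (@ordS 6) i)
   || (q == nbr p (ordS i)) && (j == iter 4 (@ordS 6) i))%:R : R).
  by apply: eq_bigr => j _; rewrite mul1r elong_unit // spoke_edge.
by rewrite sum_pick2 ?mulr1 // iter_ordS_neq.
Qed.

Lemma elong_decomp (L : elongations R T) :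
  L = \sum_(e : edges T) L e *: unit_elong (val e).
Proof.
apply/ffunP => e; rewrite sum_ffunE (bigD1 e) //= big1 => [|e' ne].
  by rewrite !ffunE eqxx addr0 [RHS]mulr1.
by rewrite !ffunE val_eqE eq_sym (negPf ne) scaler0.
Qed.

Lemma functional_ext (phi psi : 'Hom(elongations R T, R^o)) :
  (forall p i, [fset p; nbr p (ordS i)] \in edges T ->
     phi (unit_elong [fset p; nbr p (ordS i)]) =
     psi (unit_elong [fset p; nbr p (ordS i)])) -> phi = psi.
Proof.
move=> h; apply/lfunP => L; rewrite [L]elong_decomp !linear_sum /=.
apply: eq_bigr => e _; rewrite !linearZ /=; congr (_ *: _).
by have [p [i [_ eE]]] := edgesP _ hT (valP e); move: (h p i); rewrite -eE;
  apply; exact: valP.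
Qed.

Definition unit_displ (q : lattice) (u : 'rV[R]_2) : displacements R T :=
  [ffun v => (val v == q)%:R *: u].

(** Moving one vertex stretches only the edges at it; absent edges contribute zero. *)
Lemma stretch_unit q u : stretch (unit_displ q u) =
  \sum_(j < 6) dot (pt R q - pt R (nbr q j)) u *: unit_elong [fset q; nbr q j].
Proof.
apply/ffunP => e; have [p [i [iT eE]]] := edgesP _ hT (valP e).
have [pT _ nT] := tri_vertices iT.
rewrite (@stretchE _ _ _ [` pT] [` nT] e eE) /= !ffunE /= sum_ffunE.
transitivity (\sum_(j < 6) dot (pt R q - pt R (nbr q j)) u *
   ((q == p) && (j == iter 1 (@ordS 6) i)
   || (q == nbr p (ordS i)) && (j == iter 4 (@ordS 6) i))%:R); last first.
  by apply: eq_bigr => j _; rewrite !ffunE [\val e == _]eq_sym eE spoke_edge.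
rewrite sum_pick2 ?iter_ordS_neq //= ![_ == q]eq_sym.
case: eqVneq => [->|_]; case: eqVneq => [e2|_] /=.
- by move: (nbr_neq p (ordS i)); rewrite -e2 eqxx.
- by rewrite scale0r subr0 scale1r mul1r mul0r addr0.
- by subst q; rewrite nbr_back scale0r scale1r mul0r mul1r !add0r -[LHS]dotNN
    opprK opprB.
- by rewrite !scale0r subr0 !mul0r addr0 /dot big1 // => j _;
    rewrite [X in _ * X]mxE mulr0.
Qed.

(** Testing a self-stress on displacements of p alone says that the forces at p balance, here in
    lattice coordinates. *)
Lemma equilibrium (phi : 'Hom(elongations R T, R^o)) p : phi \in compat R T ->
  \sum_(j < 6) (dir j).1%:~R * phi (unit_elong [fset p; nbr p j]) = 0 /\
  \sum_(j < 6) (dir j).2%:~R * phi (unit_elong [fset p; nbr p j]) = 0.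
Proof.
move=> /mem_compat h.
have dual (c : 'rV[R]_2 -> R) (u : 'rV[R]_2) (d : 'I_6 -> int) :
    (forall x, dot x u = c x) -> (forall j, c (pt R p - pt R (nbr p j)) = - (d
      j)%:~R) ->
    \sum_(j < 6) (d j)%:~R * phi (unit_elong [fset p; nbr p j]) = 0.
  move=> uE cE; apply: oppr_inj; rewrite oppr0 -sumrN.
  rewrite -[RHS](h (unit_displ p u)) stretch_mapE stretch_unit linear_sum.
  by apply: eq_bigr => j _; rewrite [RHS]linearZ /= uE cE scaleNr.
split.
  (* The row vector represents the functional [ca] with respect to [dot]; the one below represents
     [cb]. *)
  apply: (dual (@ca R) (\row_j [:: 1; - (Num.sqrt 3)^-1]`_j)).
    move=> x; rewrite /dot big_ord_recl big_ord1 !mxE /= mulr1 mulrN.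
    by congr (_ - x _ _ / _); apply: val_inj.
  by move=> j; rewrite !coordE nbrE /= rmorphD /=; ring.
apply: (dual (@cb R) (\row_j [:: 0; 2 / Num.sqrt 3]`_j)).
  move=> x; rewrite /dot big_ord_recl big_ord1 !mxE /= mulr0 add0r mulrA.
  by congr (x _ _ * _ / _); apply: val_inj.
by move=> j; rewrite !coordE nbrE /= rmorphD /=; ring.
Qed.
End Functionals.

Lemma sum_ord6 (V : nmodType) (f : 'I_6 -> V) : \sum_j f j =
  f (inord 0) + f (inord 1) + f (inord 2) + f (inord 3) + f (inord 4) + f
    (inord 5).
Proof.
rewrite !big_ord_recr big_ord0 /= add0r.
by do ![congr (_ + _)]; congr f; apply: ord_inj; rewrite inordK.
Qed.

(** * The discrete Airy function of a stress *)

Section Airy.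
Variables (R : realType) (w : {fset lattice} -> R) (N : int).
Hypothesis eq1 : forall p,
  \sum_(j < 6) (dir j).1%:~R * w [fset p; nbr p j] = 0.
Hypothesis eq2 : forall p,
  \sum_(j < 6) (dir j).2%:~R * w [fset p; nbr p j] = 0.
Hypothesis wN : forall p i, (N <= p.1) || (N <= p.2) -> w [fset p; nbr p i] = 0.

(** The stress on each of the three families of parallel edges. *)
Let H (k l : int) := w [fset (k, l); (k + 1, l)].
Let V (k l : int) := w [fset (k, l); (k, l + 1)].
Let W (k l : int) := w [fset (k + 1, l); (k, l + 1)].

Let edge0 (k l : int) : w [fset (k, l); nbr (k, l) (inord 0)] = H k l.
Proof. by rewrite nbrE /dir inordK //= addr0. Qed.
Let edge1 (k l : int) : w [fset (k, l); nbr (k, l) (inord 1)] = V k l.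
Proof. by rewrite nbrE /dir inordK //= addr0. Qed.
Let edge2 (k l : int) : w [fset (k, l); nbr (k, l) (inord 2)] = W (k - 1) l.
Proof. by rewrite nbrE /dir inordK //= /W subrK. Qed.
Let edge3 (k l : int) : w [fset (k, l); nbr (k, l) (inord 3)] = H (k - 1) l.
Proof. by rewrite nbrE /dir inordK //= /H subrK addr0 fsetUC. Qed.
Let edge4 (k l : int) : w [fset (k, l); nbr (k, l) (inord 4)] = V k (l - 1).
Proof. by rewrite nbrE /dir inordK //= /V subrK addr0 fsetUC. Qed.
Let edge5 (k l : int) : w [fset (k, l); nbr (k, l) (inord 5)] = W k (l - 1).
Proof. by rewrite nbrE /dir inordK //= /W subrK fsetUC. Qed.

Let bal1 (k l : int) : H k l - W (k - 1) l - H (k - 1) l + W k (l - 1) = 0.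
Proof.
rewrite -[RHS](eq1 (k, l)) sum_ord6 edge0 edge2 edge3 edge5 /dir !inordK //=;
  ring.
Qed.

Let bal2 (k l : int) : V k l + W (k - 1) l - V k (l - 1) - W k (l - 1) = 0.
Proof.
rewrite -[RHS](eq2 (k, l)) sum_ord6 edge1 edge2 edge4 edge5 /dir !inordK //=;
  ring.
Qed.

(** The number of integers from k up to N - 1, which is 0 beyond N. *)
Let height (k : int) : nat := if (N - k)%R is Posz n then n else 0%N.

Let heightE (k : int) : k <= N -> (height k)%:Z = N - k.
Proof. by rewrite /height; case: (N - k) (subr_ge0 k N) => // n <-. Qed.

Let height0 (k : int) : N <= k -> height k = 0%N.
Proof. by rewrite /height => Nk; case E : (N - k) => [n|//]; lia. Qed.

(* W determines a by a second difference, so a is a double sum of W over the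
   quadrant beyond p. *)
Definition airy (p : lattice) : R :=
  \sum_(i < height p.1) \sum_(j < height p.2) W (N - 1 - i%:Z) (N - 1 - j%:Z).

Lemma airy0 p : (N <= p.1) || (N <= p.2) -> airy p = 0.
Proof.
rewrite /airy => /orP[] /height0 ->; first by rewrite big_ord0.
by rewrite big1 // => i _; rewrite big_ord0.
Qed.

(** The mixed second difference of a double sum is its corner term; beyond N both sides vanish. *)
Let relW (k l : int) : W k l =
  airy (k, l) + airy (k + 1, l + 1) - airy (k + 1, l) - airy (k, l + 1).
Proof.
have [Nk|kN] := lerP N k.
  rewrite -[l](addrK 1) -edge5 wN /= ?Nk // !airy0 /= ?addr0 ?subr0 //; lia.
have [Nl|lN] := lerP N l.
  rewrite -[k](addrK 1) -edge2 wN /= ?Nl ?orbT // !airy0 /= ?addr0 ?subr0 //;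
    lia.
have hS m : m < N -> height m = (height (m + 1)).+1.
  by move=> mN; have := @heightE m; have := @heightE (m + 1); lia.
have hE m : m < N -> N - 1 - (height (m + 1))%:Z = m.
  by move=> mN; rewrite heightE; lia.
rewrite /airy /= (hS _ kN) (hS _ lN) !big_ord_recr /= hE //.
rewrite [X in _ = _ + X - _ - _](_ : _ =
  \sum_(i < height (k + 1)) \sum_(j < height (l + 1)) W (N - 1 - i%:Z) (N - 1 -
    j%:Z)) //.
set u := \sum_(_ < height (l + 1)) W k _.
have -> : \sum_(i < height (k + 1)) \sum_(j < (height (l + 1)).+1)
    W (N - 1 - i%:Z) (N - 1 - j%:Z) =
  \sum_(i < height (k + 1)) \sum_(j < height (l + 1))
    W (N - 1 - i%:Z) (N - 1 - j%:Z) + \sum_(i < height (k + 1)) W (N - 1 -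
      i%:Z) l.
  by rewrite -big_split; apply: eq_bigr => i _; rewrite big_ord_recr /= hE.
rewrite hE //; ring.
Qed.

(* The residuals of the two other edge directions are constant along lines by
   equilibrium, and zero far away. *)
Let descend (f : int -> R) : (forall k, f k = f (k - 1)) ->
  (forall k, N <= k -> f k = 0) -> forall k, f k = 0.
Proof.
move=> step fN k; have h n : f (k + n%:Z) = f k.
  elim: n => [|n <-]; first by rewrite addr0.
  by rewrite step; congr f; lia.
by rewrite -(h `|N - k|%N); apply: fN; lia.
Qed.

Let relH (k l : int) : H k l =
  airy (k, l + 1) + airy (k + 1, l - 1) - airy (k, l) - airy (k + 1, l).
Proof.
apply/eqP; rewrite -subr_eq0; apply/eqP.
pose f k := H k l - (airy (k, l + 1) + airy (k + 1, l - 1) - airy (k, l) - airy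
  (k + 1, l)).
apply: (@descend f) => {}k; rewrite /f; last first.
  by move=> Nk; rewrite -edge0 wN ?Nk // !airy0 /= ?Nk ?(ler_wpDr _ Nk) //;
    ring.
have := bal1 k l; have := relW (k - 1) l; have := relW k (l - 1).
by rewrite !subrK => -> ->; lra.
Qed.

Let relV (k l : int) : V k l =
  airy (k + 1, l) + airy (k - 1, l + 1) - airy (k, l) - airy (k, l + 1).
Proof.
apply/eqP; rewrite -subr_eq0; apply/eqP.
pose f l := V k l - (airy (k + 1, l) + airy (k - 1, l + 1) - airy (k, l) - airy
  (k, l + 1)).
apply: (@descend f) => {}l; rewrite /f; last first.
  by move=> Nl; rewrite -edge1 wN ?Nl ?orbT // !airy0 /= ?Nl ?(ler_wpDr _ Nl)
    ?orbT //; ring.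
have := bal2 k l; have := relW (k - 1) l; have := relW k (l - 1).
by rewrite !subrK => -> ->; lra.
Qed.

Lemma airy_edge p i : w [fset p; nbr p (ordS i)] =
  airy (nbr p i) + airy (nbr p (ordS (ordS i))) - airy p - airy (nbr p (ordS
    i)).
Proof.
case: p => k l; rewrite !ordS6E; move: i; apply: ord6P; rewrite !inordK //=.
- by rewrite edge1 relV !nbrE /dir !inordK //= !addr0.
- by rewrite edge2 relW !nbrE /dir !inordK //= !addr0 !subrK; ring.
- rewrite edge3 relH !nbrE /dir !inordK //= !addr0 !subrK; ring.
- rewrite edge4 relV !nbrE /dir !inordK //= !addr0 !subrK; ring.
- rewrite edge5 relW !nbrE /dir !inordK //= !addr0 !subrK; ring.
- rewrite edge0 relH !nbrE /dir !inordK //= !addr0; ring.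
Qed.
End Airy.

(** The coefficients of each displacement agree. For [u i] both are V_i - V_0, since V_(i-1) +
    V_(i+1) = V_i + V_0; for [u0] the six directions sum to zero. *)
Lemma wheel_identity (R : realType) p (u0 : 'rV[R]_2) (u : 'I_6 -> 'rV[R]_2) :
  \sum_i dot (pt R (nbr p i) - pt R (nbr p (ordS i))) (u i - u (ordS i)) =
  \sum_i dot (pt R p - pt R (nbr p i)) (u0 - u i).
Proof.
have S k : (k < 6)%N -> ordS (inord k : 'I_6) = inord (k.+1 %% 6).
  by move=> k6; rewrite ordS6E inordK.
rewrite !sum_ord6 !S //= !dot_coord !coordE !nbrE /= !rmorphD /= /dir.
by rewrite !inordK //=; field.
Qed.

Lemma wheel_edges (T : {fset {fset lattice}}) p i :
  (forall t, t \in T -> exists q j, t = tri q j) -> (forall j, tri p j \in T) ->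
  ([fset nbr p i; nbr p (ordS i)] \in edges T) && ([fset p;
    nbr p i] \in edges T).
Proof.
move=> hT pT; have [r1 r2 r3] := tri_rot p i.
have [s1 s2 s3] := tri_rot (nbr p i) (ordS (ordS i)).
apply/andP; split; apply/(edgesP _ hT).
  exists (nbr p (ordS i)), (ordS (ordS (ordS (ordS i)))).
  by rewrite -r2 s1 r1 s3 fsetUC r2.
exists (nbr p i), (ordS (ordS i)); by rewrite r1 r3 fsetUC.
Qed.

(** * Wagon wheels: compatibility, support, independence *)

Section Basis.
Variables (R : realType) (T : {fset {fset lattice}}).
Hypothesis hT : forall t, t \in T -> exists q j, t = tri q j.
Let iv := interior_vertices R T.

Lemma elong_stretch (U : displacements R T) p q :
  [fset p; q] \in edges T ->
  elong (stretch U) p q = dot (pt R p - pt R q) (at_ U p - at_ U q).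
Proof.
move=> eT; have [pT qT] : p \in vertices T /\ q \in vertices T.
  have [p' [i [/tri_vertices[h1 _ h2] /eqP]]] := edgesP _ hT eT.
  by rewrite fset2_eq => /orP[] /andP[/eqP-> /eqP->].
rewrite /elong -[[fset p; q]]/(val [` eT]) at_in.
rewrite (@stretchE _ _ _ [` pT] [` qT]) //=.
by rewrite -(at_in U [` pT]) -(at_in U [` qT]).
Qed.

Lemma wagon_compat p : p \in iv -> wagon R T p \in compat R T.
Proof.
move=> /(interior_verticesP R _ hT) pT; apply/mem_compat => U.
rewrite stretch_mapE wagonE.
under eq_bigr => i _ do rewrite elong_stretch ?(andP (wheel_edges i hT pT)).1
  //.
under [X in _ - X]eq_bigr => i _ do rewrite elong_stretch ?(andP (wheel_edges i
  hT pT)).2 //.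
apply/eqP; rewrite subr_eq0; apply/eqP.
exact: (wheel_identity p (at_ U p) (fun i => at_ U (nbr p i))).
Qed.

Lemma wagon_supported p : supported_on (edges (hexagon p)) (wagon R T p).
Proof.
(* The hexagon takes the place of T in [wheel_edges]. *)
have hexT t : t \in hexagon p -> exists q j, t = tri q j.
  by move=> /imfsetP[i _ ->]; exists p, i.
have hexI i : tri p i \in hexagon p by apply/imfsetP; exists i.
move=> L L0; have out x y : [fset x;
  y] \in edges (hexagon p) -> elong L x y = 0.
  move=> xyH; rewrite /elong /at_; case: insubP => [e _ eE|//] /=.
  by rewrite L0 // eE.
rewrite wagonE !big1 ?subr0 // => i _; rewrite out //.
  by have /andP[] := wheel_edges i hexT hexI.
by have /andP[] := wheel_edges i hexT hexI.
Qed.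

(** A combination of wheels acts on an edge by the second difference of its coefficients; extended
    by zero off [iv], these can be read at all four vertices involved. *)
Lemma sum_wagon (a : lattice -> R) p i :
  (forall q, q \notin iv -> a q = 0) -> [fset p; nbr p (ordS i)] \in edges T ->
  (\sum_(q <- iv) a q *: wagon R T q) (unit_elong R T [fset p;
    nbr p (ordS i)]) =
  a (nbr p (ordS (ordS i))) + a (nbr p i) - (a p + a (nbr p (ordS i))).
Proof.
move=> a0 eT; rewrite sum_lfunE.
have pick r : \sum_(q <- iv) a q * (q == r)%:R = a r.
  have [rI|rI] := boolP (r \in iv); last first.
    rewrite a0 // big_seq big1 // => q qI; case: eqVneq => [e|];
      last by rewrite mulr0.
    by rewrite -e qI in rI.
  rewrite (big_fsetD1 r) //= eqxx mulr1 big1_fset ?addr0 // => q.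
  by rewrite !inE => /andP[/negPf->]; rewrite mulr0.
rewrite -!pick -!big_split -sumrB; apply: eq_bigr => q _.
by rewrite lfunE /= wagon_unit // -!mulrDr -mulrBr.
Qed.

(* If p has maximal coordinate sum among the points with a p <> 0, then the edge
   joining p + e1 and p + e2 only sees p. *)
Lemma wagon_free : free [seq wagon R T p | p <- iv].
Proof.
set X := map _ _.
have sX : size X = size (enum_fset iv) by rewrite size_map.
suff key (a : lattice -> R) : (forall q, q \notin iv -> a q = 0) ->
    \sum_(q <- iv) a q *: wagon R T q = 0 -> forall p, a p = 0.
  apply/(freeP (X := in_tuple X)) => k k0 i.
  pose a p := if p \in iv then oapp k 0 (insub (index p (iv : seq _))) else 0.
  have aE (j : 'I_(size X)) : a (nth 0 iv j) = k j.
    have jI : (j < size (enum_fset iv))%N by rewrite -sX.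
    rewrite /a ifT; last exact: mem_nth.
    by rewrite index_uniq ?fset_uniq // valK.
  rewrite -aE; apply: key => [q /negPf qI|]; first by rewrite /a qI.
  rewrite (big_nth 0) big_mkord -sX -[RHS]k0.
  apply: eq_bigr => j _; rewrite aE; congr (_ *: _).
  by rewrite (nth_map 0) // -sX.
move=> a0 s0 p1; apply/eqP/negPn/negP => p1a.
pose A := [fset p in iv | a p != 0].
have memA q : (q \in A) = (q \in iv) && (a q != 0) by rewrite !inE.
have p1A : p1 \in A.
  by rewrite memA p1a andbT; apply: contraR p1a => /a0->.
have [v _ vmax] := @Order.TotalTheory.arg_maxP _ _ _ [` p1A] predT
  (fun v : A => (val v).1 + (val v).2) isT.
have := valP v; rewrite memA => /andP[]; set p := val v => pI pa.
have big q : p.1 + p.2 < q.1 + q.2 -> a q = 0.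
  move=> lt; apply/eqP/negPn/negP => qa.
  have qA : q \in A by rewrite memA qa andbT; apply: contraR qa => /a0->.
  by have := vmax [` qA] isT; rewrite /= -/p leNgt lt.
have pT := elimT (interior_verticesP R _ hT) pI.
(* The edge runs from q = p + e_2 to p + e_1. The vertices opposite to it are p and p + e_1 + e_2,
   and all but p have a larger coordinate sum than p. *)
pose q := nbr p (inord 1); pose j : 'I_6 := inord 4.
have qT : [fset q; nbr q (ordS j)] \in edges T.
  apply/(edgesP _ hT); exists q, j; split => //.
  rewrite (_ : tri q j = tri p (inord 0)) //; apply: slab_tri_eq.
  by rewrite /slab_at !xpair_eqE /q nbrE /slab /dir /j !inordK //=; lia.
have := sum_wagon a0 qT; rewrite s0 zero_lfunE.
have -> : nbr q j = p.
  by apply/eqP; rewrite [p]surjective_pairing /q /j !nbrE /dir !inordK //=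
    xpair_eqE; lia.
rewrite (big (nbr q (ordS (ordS j)))) ?(big q) ?(big (nbr q (ordS j)));
  first by rewrite add0r addr0 subr0 => /esym/eqP; rewrite (negPf pa).
all: by rewrite /q /j ?ordS6E !nbrE /dir !inordK //= ?inordK //=; lia.
Qed.

End Basis.

(** * Wagon wheels span; dimension of the compatibility conditions *)

Section Genericity.
Variables (R : realType) (T : {fset {fset lattice}}).
Hypothesis hT : forall t, t \in T -> exists q j, t = tri q j.
Hypothesis hX : simple_closed_curve R (boundary (region R T)).
Let iv := interior_vertices R T.

Lemma nbr_fst p i : p.1 - 1 <= (nbr p i).1.
Proof. by rewrite nbrE /=; case: i => [[|[|[|[|[|[|//]]]]]] ?];
  rewrite /dir /=; lia. Qed.

Lemma compat_span phi : phi \in compat R T ->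
  exists a : lattice -> R, phi = \sum_(p <- iv) a p *: wagon R T p.
Proof.
move=> phiC; have [N hN] := vertices_bounded T.
pose w s : R := phi (unit_elong R T s).
have w0 s : s \notin edges T -> w s = 0.
  move=> sT; rewrite /w (_ : unit_elong R T s = 0) ?linear0 //.
  apply/ffunP => e; rewrite !ffunE; case: eqVneq => // es.
  by rewrite -es (valP e) in sT.
have wN p i : (N <= p.1) || (N <= p.2) -> w [fset p; nbr p i] = 0.
  move=> pN; apply: w0;
    apply: contraL pN => /(edgesP _ hT)[q [j [/tri_vertices[q1 _ q2] e]]].
  have : p \in [fset q; nbr q (ordS j)] by rewrite -e !inE eqxx.
  by rewrite !inE => /orP[]/eqP ->; rewrite negb_or -!ltNge;
    [have [-> ->] := hN _ q1|have [-> ->] := hN _ q2].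
have eq1 p := (equilibrium hT p phiC).1;
  have eq2 p := (equilibrium hT p phiC).2.
pose a := airy w N.
have aE p i : w [fset p; nbr p (ordS i)] =
    a (nbr p i) + a (nbr p (ordS (ordS i))) - a p - a (nbr p (ordS i)).
  exact: airy_edge.
pose van (t : {fset lattice}) := `[< forall p, p \in t -> a p = 0 >].
(* The triangles outside T where a is not zero at all three vertices. Across an edge with no
   triangle of T beside it the stress is zero, so vanishing passes from one side to the other. *)
pose S t := (t \notin T) && ~~ van t.
have vanP p i : reflect [/\ a p = 0, a (nbr p i) = 0 & a (nbr p (ordS i)) = 0]
  (van (tri p i)).
  apply: (iffP (asboolP _)) => [h|[h1 h2 h3] q]; first by split; apply: h;
    rewrite !inE eqxx ?orbT.
  by rewrite !inE => /orP[/orP[]|] /eqP->.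
(* The extra 1 is there because a vertex of the triangle may lie one column to the left of its base
   point. *)
have SN k l i : N + 1 <= k -> ~~ S (tri (k, l) i).
  move=> Nk; rewrite negb_and negbK; apply/orP; right; apply/negPn/vanP.
  have := nbr_fst (k, l) i; have := nbr_fst (k, l) (ordS i) => /= h1 h2.
  by split; apply: airy0 => /=; apply/orP; left; lia.
have Sbd p i : boundary_edge S p i -> boundary_edge (fun t => t \in T) p i.
  apply: contraLR; rewrite /boundary_edge => h;
    have {h} : (tri p i \in T) = (tri p (ordS i) \in T).
    by move: h; case: (_ \in T); case: (_ \in T).
  rewrite /S; have [iT <-|iT /esym iT'] := boolP (tri p i \in T);
    first by rewrite addbb.
  rewrite iT' /=; have := aE p i; rewrite w0; last first.
    apply/negP => /edge_tri - /(_ hT); by rewrite iT' (negPf iT).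
  move=> rel; suff -> : van (tri p i) = van (tri p (ordS i)) by rewrite addbb.
  by apply/vanP/vanP => -[h1 h2 h3]; split=> //; move: rel; rewrite h1 h2 h3;
    lra.
have S0 p i : ~~ S (tri p i).
  (* In the second alternative S would coincide with T, although it lies outside T; so it is empty
     again. *)
  have [h|h] := boundary_minimal hT hX SN Sbd; first exact: h.
  by have := h p i; rewrite /S; case: (_ \in T) => //= ->.
have a0 p : p \notin iv -> a p = 0.
  move=> pI; have [i iT] : exists i, tri p i \notin T.
    apply/existsP; apply: contraR pI => /existsPn h;
      apply/(interior_verticesP R _ hT) => i.
    by have := h i; rewrite negbK.
  by have := S0 p i; rewrite /S iT /= negbK => /vanP[].
exists a; apply: (functional_ext hT) => p i eT.
by rewrite sum_wagon // -/(w _) aE; lra.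
Qed.

Lemma wagon_basis : basis_of (compat R T) [seq wagon R T p | p <- iv].
Proof.
rewrite /basis_of (wagon_free R hT) andbT eqEsubv; apply/andP; split.
  by apply/span_subvP => _ /mapP[p pI ->]; exact: wagon_compat.
apply/subvP => phi /compat_span[a ->]; rewrite big_seq.
by apply: memv_suml => p pI; apply/memvZ/memv_span/map_f.
Qed.

Lemma dim_elongations : \dim {: elongations R T} = #|` edges T|.
Proof. by rewrite dimvf /dim /= -cardfE [X in (_ * X)%N](_ : _ = 1%N) // muln1.
  Qed.

Lemma dim_displacements : \dim {: displacements R T} = (2 * #|` vertices T|)%N.
Proof.
by rewrite dimvf /dim /= -cardfE [X in (_ * X)%N](_ : _ = 2%N) // mulnC.
Qed.

(* Its kernel is [compat R T], and it is onto. *)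
Definition restrict_range (phi : 'Hom(elongations R T, R^o)) :
    'Hom(subvs_of (limg (stretch_map R T)), R^o) :=
  (phi \o linfun vsval)%VF.

Lemma restrict_linear : linear restrict_range.
Proof. by move=> a f g; rewrite /restrict_range comp_lfunDl comp_lfunZl. Qed.

HB.instance Definition _ := GRing.isLinear.Build R _ _ _ restrict_range
  restrict_linear.

(** Rank and nullity of [restrict_range]; it is onto because a functional on the range extends to
    all elongations through a projection. *)
Lemma dim_compat : \dim (compat R T) = num_compat R T.
Proof.
have kerE : lker (linfun restrict_range) = compat R T.
  apply/vspaceP => phi; rewrite memv_ker lfunE /=;
    apply/eqP/idP => [/lfunP h|/mem_compat h].
    apply/mem_compat => U;
      have UI : stretch_map R T U \in limg (stretch_map R T).
      by rewrite memv_img ?memvf.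
    by have := h (Subvs UI); rewrite comp_lfunE lfunE zero_lfunE.
  apply/lfunP => x; rewrite comp_lfunE lfunE zero_lfunE /=.
  by have /memv_imgP[U _ ->] := subvsP x.
have imgE : limg (linfun restrict_range) = fullv.
  apply/vspaceP => psi; rewrite memvf.
  rewrite (_ : psi = linfun restrict_range (psi \o linfun (vsproj _))%VF).
    by rewrite memv_img ?memvf.
  apply/lfunP => x; rewrite lfunE /= /restrict_range !comp_lfunE !lfunE /=.
  by rewrite vsvalK.
have := limg_ker_dim (linfun restrict_range) fullv.
rewrite capfv kerE imgE !dimvf /num_compat => e.
apply: (@addIn (\dim (limg (stretch_map R T)))).
rewrite subnK ?dimvS ?subvf // dimvf; move: e.
have dH (V : vectType R) : dim 'Hom(V, R^o) = dim V.
  by rewrite /dim /= [X in (_ * X)%N](_ : _ = 1%N) // muln1.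
by rewrite !dH => <-.
Qed.
End Genericity.

(** * Rigidity *)

Lemma dot_dir (R : realType) p i : let d := pt R (nbr p i) - pt R p in dot d d
  = 1.
Proof.
rewrite /= dot_coord !coordE nbrE /= !rmorphD /= /dir.
by case: i => [[|[|[|[|[|[|//]]]]]] ?] /=; field.
Qed.

Lemma dot_row (R : realType) (u v : 'rV[R]_2) : dot u v = u 0 0 * v 0 0 + u 0 1
  * v 0 1.
Proof.
rewrite /dot big_ord_recl big_ord1; congr (_ + u _ _ * v _ _); exact: val_inj.
Qed.

Lemma row2P (R : realType) (u v : 'rV[R]_2) :
  u 0 0 = v 0 0 -> u 0 1 = v 0 1 -> u = v.
Proof. by move=> h0 h1; apply: coord_inj; rewrite /ca /cb ?h0 h1. Qed.

Section Rigidity.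
Variables (R : realType) (T : {fset {fset lattice}}).
Hypothesis hT : forall t, t \in T -> exists q j, t = tri q j.

(** The displacement of the third vertex is orthogonal to two edges of independent directions. *)
Lemma third_vertex (U : displacements R T) p i : stretch U = 0 ->
  tri p i \in T -> at_ U p = 0 -> at_ U (nbr p i) = 0 ->
  at_ U (nbr p (ordS i)) = 0.
Proof.
move=> U0 iT up un; have [r1 r2 r3] := tri_rot p i.
have [s1 s2 s3] := tri_rot (nbr p i) (ordS (ordS i)).
have zero x y : [fset x; y] \in edges T ->
    dot (pt R x - pt R y) (at_ U x - at_ U y) = 0.
  move=> xyT; rewrite -elong_stretch // U0 /elong /at_.
  by case: insub => //= e; rewrite ffunE.
have e1 : [fset p; nbr p (ordS i)] \in edges T by apply/(edgesP _ hT);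
  exists p, i.
have e2 : [fset nbr p i; nbr p (ordS i)] \in edges T.
  apply/(edgesP _ hT); exists (nbr p (ordS i)), (ordS (ordS (ordS (ordS i)))).
  by rewrite -r2 s1 r1 s3 fsetUC r2.
have := zero _ _ e1; have := zero _ _ e2; rewrite up un !sub0r.
move: (at_ U _) => u; rewrite !dot_coord !coordE !nbrE /= !rmorphD /= => h1 h2.
(* Zero is written as a multiple so that [coordE] computes its coordinates. *)
apply: coord_inj; rewrite -(scale0r (0 : 'rV[R]_2)) !coordE mul0r;
  move: h1 h2; rewrite /dir;
    case: i {iT un r1 r2 r3 s1 s2 s3 e1 e2} => [[|[|[|[|[|[|//]]]]]] ?] /=; lra.
Qed.

(** The same argument with the triangle named from [nbr p (ordS i)]. *)
Lemma third_vertex_back (U : displacements R T) p i : stretch U = 0 ->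
  tri p i \in T -> at_ U p = 0 -> at_ U (nbr p (ordS i)) = 0 ->
  at_ U (nbr p i) = 0.
Proof.
move=> U0 iT up un; have [r1 r2 r3] := tri_rot p i.
have := tri_rot (nbr p i) (ordS (ordS i)); rewrite /= r1 r2 r3 => -[s1 s2 s3].
by rewrite -s3; apply: third_vertex; rewrite ?s1 ?s2.
Qed.

(* The velocity field of a translation by (c_0, c_1) plus a rotation of speed
   c_2. *)
Definition rigid (c : 'rV[R]_3) : displacements R T :=
  [ffun v => \row_j [:: c 0 0 - c 0 2 * pt R (val v) 0 1;
                        c 0 1 + c 0 2 * pt R (val v) 0 0]`_j].

Lemma rigid_linear : linear rigid.
Proof.
move=> a f g; apply/ffunP => v; rewrite !ffunE.
by apply: row2P; rewrite !mxE /=; ring.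
Qed.

HB.instance Definition _ := GRing.isLinear.Build R _ _ _ rigid rigid_linear.

Lemma stretch_rigid c : stretch (rigid c) = 0.
Proof.
apply/ffunP => e; have [p [i [iT eE]]] := edgesP _ hT (valP e).
have [pT _ nT] := tri_vertices iT.
rewrite (@stretchE _ _ _ [` pT] [` nT] e eE) !ffunE dot_row !mxE /=; ring.
Qed.

Lemma rigid_inj c p i : tri p i \in T -> rigid c = 0 -> c = 0.
Proof.
move=> iT c0; have [pT nT _] := tri_vertices iT.
have := dot_dir R p i; rewrite /= dot_row.
have := congr1 (fun U : displacements R T => U [` pT]) c0.
have := congr1 (fun U : displacements R T => U [` nT]) c0; rewrite !ffunE.
move=> hn hp.
have := congr1 (fun u : 'rV[R]_2 => u 0 0) hn;
  have := congr1 (fun u : 'rV[R]_2 => u 0 1) hn.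
have := congr1 (fun u : 'rV[R]_2 => u 0 0) hp;
  have := congr1 (fun u : 'rV[R]_2 => u 0 1) hp.
rewrite ![(\row__ _) _ _]mxE /= ![(0 : 'rV[R]_2) _ _]mxE.
rewrite ![(_ - _ : 'rV[R]_2) _ _]mxE ![(- _ : 'rV[R]_2) _ _]mxE.
move: (pt R p 0 0) (pt R p 0 1) (pt R (nbr p i) 0 0) (pt R (nbr p i) 0 1).
move=> x y x' y' h1 h2 h3 h4 d1.
(* The difference of the velocities at the two vertices is the rotation speed times a turned unit
   vector. *)
have c2 : c 0 2 = 0.
  rewrite -[c 0 2]mulr1 -d1.
  transitivity ((x' - x) * (c 0 2 * x' - c 0 2 * x) + (y' - y) * (c 0 2 * y' -
    c 0 2 * y)).
    by ring.
  have -> : c 0 2 * x' - c 0 2 * x = 0 by lra.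
  have -> : c 0 2 * y' - c 0 2 * y = 0 by lra.
  by rewrite !mulr0 addr0.
rewrite c2 !mul0r in h1 h2.
apply/rowP => -[[|[|[|//]]] k]; rewrite mxE.
- by rewrite -[RHS]h2 subr0; congr (c _ _); apply: val_inj.
- by rewrite -[RHS]h1 addr0; congr (c _ _); apply: val_inj.
- by rewrite -[RHS]c2; congr (c _ _); apply: val_inj.
Qed.

(** The edge keeps its length to first order, so the relative velocity of its ends is perpendicular
    to it, as in a rotation. *)
Lemma rigid_match (U : displacements R T) p i : tri p i \in T -> stretch U = 0
  ->
  exists c, at_ (U - rigid c) p = 0 /\ at_ (U - rigid c) (nbr p i) = 0.
Proof.
move=> iT U0; have [pT nT _] := tri_vertices iT.
have eT : [fset nbr p i; p] \in edges T.
  have [r1 r2 r3] := tri_rot p i; apply/(edgesP _ hT).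
  by exists (nbr p i), (ordS (ordS i)); rewrite r1 r3.
have atp (V : displacements R T) : at_ V p = V [` pT] := at_in V [` pT].
have atn (V : displacements R T) : at_ V (nbr p i) = V [` nT] := at_in V [` nT].
have h : dot (pt R (nbr p i) - pt R p) (U [` nT] - U [` pT]) = 0.
  rewrite -atp -atn -elong_stretch // U0 /elong /at_.
  by case: insub => //= e; rewrite ffunE.
have [c hc] : exists c : 'rV[R]_3,
    U [` pT] = rigid c [` pT] /\ U [` nT] = rigid c [` nT].
  move: h (dot_dir R p i); rewrite /= !dot_row /rigid.
  under eq_exists => c do rewrite !ffunE.
  move: (pt R p) (pt R (nbr p i)) (U [` pT]) (U [` nT]) => /= x y u v.
  rewrite ![(_ - _ : 'rV[R]_2) _ _]mxE ![(- _ : 'rV[R]_2) _ _]mxE => h d1.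
  (* The rotation speed, as the cross product of the unit edge vector with the relative velocity;
     the translation is then fixed by matching at x. *)
  pose t := (y 0 0 - x 0 0) * (v 0 1 - u 0 1) - (y 0 1 - x 0 1) * (v 0 0 - u 0
    0).
  exists (\row_j [:: u 0 0 + t * x 0 1; u 0 1 - t * x 0 0; t]`_j).
  split; apply: row2P; rewrite !mxE /=; first by ring.
  - by ring.
  - apply/eqP; rewrite -subr_eq0; apply/eqP.
    (* The difference is a combination of two zero quantities: 1 minus the squared edge length, and
       the elongation. *)
    transitivity ((v 0 0 - u 0 0) * (1 - ((y 0 0 - x 0 0) * (y 0 0 - x 0 0) +
        (y 0 1 - x 0 1) * (y 0 1 - x 0 1))) + (y 0 0 - x 0 0) *
        ((y 0 0 - x 0 0) * (v 0 0 - u 0 0) + (y 0 1 - x 0 1) * (v 0 1 - u 0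
          1))).
      by rewrite /t; ring.
    by rewrite d1 h; ring.
  - apply/eqP; rewrite -subr_eq0; apply/eqP.
    transitivity ((v 0 1 - u 0 1) * (1 - ((y 0 0 - x 0 0) * (y 0 0 - x 0 0) +
        (y 0 1 - x 0 1) * (y 0 1 - x 0 1))) + (y 0 1 - x 0 1) *
        ((y 0 0 - x 0 0) * (v 0 0 - u 0 0) + (y 0 1 - x 0 1) * (v 0 1 - u 0
          1))).
      by rewrite /t; ring.
    by rewrite d1 h; ring.
by exists c; rewrite atp atn !ffunE hc.1 hc.2 !ffunE !subrr.
Qed.

Hypothesis hX : simple_closed_curve R (boundary (region R T)).

(** The curve has a point, while the closure of an empty region has none. *)
Lemma truss_nonempty : exists p i, tri p i \in T.
Proof.
have [g [_ _ _ gC]] := hX.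
have : boundary (region R T) (g 0).
  by rewrite -gC; exists 0 => //=; rewrite in_itv /= lexx ler01.
move=> [cl _]; have [x [[t /= tT _] _]] := cl setT filterT.
by have [p [i tE]] := hT tT; exists p, i; rewrite -tE.
Qed.

Lemma flex_zero (U : displacements R T) p i : stretch U = 0 -> tri p i \in T ->
  at_ U p = 0 -> at_ U (nbr p i) = 0 -> U = 0.
Proof.
move=> U0 iT up un; have [N hN] := vertices_bounded T.
pose van (t : {fset lattice}) := `[< forall p, p \in t -> at_ U p = 0 >].
(* Two adjacent triangles of T share an edge, so by [third_vertex] and its converse form the flex
   vanishes on both or on neither. *)
pose S t := (t \in T) && van t.
have vanP q j : reflect [/\ at_ U q = 0, at_ U (nbr q j) = 0 & at_ U (nbr q
  (ordS j)) = 0]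
    (van (tri q j)).
  apply: (iffP (asboolP _)) => [h|[h1 h2 h3] r]; first by split; apply: h;
    rewrite !inE eqxx ?orbT.
  by rewrite !inE => /orP[/orP[]|] /eqP->.
have SN k l j : N <= k -> ~~ S (tri (k, l) j).
  move=> Nk; apply/nandP; left;
    apply: contraL Nk => /tri_vertices[/hN[/= kN _] _ _].
  by rewrite -ltNge.
have Sbd q j : boundary_edge S q j -> boundary_edge (fun t => t \in T) q j.
  apply: contraLR; rewrite /boundary_edge => h;
    have {h} : (tri q j \in T) = (tri q (ordS j) \in T).
    by move: h; case: (_ \in T); case: (_ \in T).
  rewrite /S; have [jT /esym jT'|jT <-] := boolP (tri q j \in T);
    last by rewrite addbb.
  rewrite jT' /=; suff -> : van (tri q j) = van (tri q (ordS j)) by rewrite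
    addbb.
  apply/vanP/vanP => -[h1 h2 h3]; split=> //.
    exact: third_vertex.
  exact: third_vertex_back.
have ST q j : tri q j \in T -> van (tri q j).
  have [h|h] := boundary_minimal hT hX SN Sbd.
    have := h p i; rewrite /S iT /= => /vanP[]; split=> //; exact: third_vertex.
  by move=> jT; have := h q j; rewrite /S jT.
apply/ffunP => v; rewrite ffunE -at_in.
have /mem_vertices[t tT vt] := valP v; have [q [j tE]] := hT tT; subst t.
by have /asboolP := ST _ _ tT; apply.
Qed.

(** A flex minus the rigid motion that matches it on one edge is zero by [flex_zero]. *)
Lemma lker_stretch : lker (stretch_map R T) = limg (linfun rigid).
Proof.
apply/vspaceP => U; rewrite memv_ker stretch_mapE; apply/eqP/memv_imgP.
  move=> U0; have [p [i iT]] := truss_nonempty.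
  have [c [c1 c2]] := rigid_match iT U0; exists c; rewrite ?memvf // lfunE /=.
  apply/eqP; rewrite -subr_eq0; apply/eqP; apply: flex_zero iT c1 c2.
  by rewrite linearB /= U0 stretch_rigid subr0.
by move=> [c _ ->]; rewrite lfunE /= stretch_rigid.
Qed.

(** The kernel has dimension 3, so the range has dimension 2v - 3 and codimension e - 2v + 3. *)
Lemma truss_generic : generic R T.
Proof.
have [p [i iT]] := truss_nonempty.
have d3 : \dim (lker (stretch_map R T)) = 3.
  rewrite lker_stretch limg_dim_eq ?dimvf //; apply/eqP; rewrite -subv0.
  apply/subvP => c; rewrite memv_cap memv_ker lfunE /= => /andP[_ /eqP c0].
  by rewrite (rigid_inj iT c0) mem0v.
have := limg_ker_dim (stretch_map R T) fullv;
  rewrite capfv d3 dim_displacements.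
rewrite /generic /num_compat /maxwell dim_elongations => e.
(* [num_compat] is a truncated subtraction; this bound makes it a true difference. *)
have : (\dim (limg (stretch_map R T)) <= #|` edges T|)%N.
  by rewrite -(dim_elongations R) dimvS ?subvf.
by lia.
Qed.
End Rigidity.

Theorem theorem12 (R : realType) (T : {fset {fset lattice}})
    (hT : forall t, t \in T -> unit_triangle R t)
    (hX : simple_closed_curve R (boundary (region R T))) :
  generic R T /\
  maxwell T = #|` interior_vertices R T|%:Z /\
  basis_of (compat R T) [seq wagon R T p | p <- interior_vertices R T] /\
  (forall p, p \in interior_vertices R T ->
     supported_on (edges (hexagon p)) (wagon R T p)).
Proof.
have hT' t : t \in T -> exists p i, t = tri p i by move=> /hT/unit_triangle_tri.
have gen := truss_generic hT' hX; have basis := wagon_basis hT' hX.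
split=> //; split; last by split=> // p _; exact: wagon_supported.
(* The basis has as many elements as there are interior vertices, and the dimension it spans is c,
   already known to be the Maxwell number. *)
have := size_basis (X := in_tuple _) basis; rewrite size_map => <-.
by rewrite dim_compat.
Qed.
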